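(* Let $\Theta$ be a finite oriented graph and let $K$ be a field. Then the following conditions are equivalent: 1) $K[\mathrm{HK}_{\Theta}]$ is right Noetherian; 2) $K[\mathrm{HK}_{\Theta}]$ is left Noetherian; 3) each of the connected components of $\Theta$ is either an oriented cycle or an acyclic graph.
   Context: A finite oriented graph $\Theta$ here is a finite simple digraph with vertex set $\{1,\dots,n\}$ in which any two distinct vertices are either not connected or are connected by exactly one arrow (no loops, no multiple arrows, no unoriented edges). The Hecke--Kiselman monoid $\mathrm{HK}_\Theta$ is the monoid generated by $x_1,\dots,x_n$ subject to: $x_i^2=x_i$ for all $i$; $x_ix_j=x_jx_i$ if $i,j$ are not connected in $\Theta$; $x_ix_jx_i=x_jx_ix_j=x_ix_j$ if there is an arrow $i\to j$ in $\Theta$. $K[\mathrm{HK}_\Theta]$ is the monoid algebra over $K$. Connected components are those of the underlying undirected graph. An oriented cycle is a graph $v_1\to v_2\to\cdots\to v_m\to v_1$ with $m\ge 3$ distinct vertices and no further arrows; a graph is acyclic if it contains no oriented cycle. *)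

(* Defs.v *)
From HB Require Import structures.
From mathcomp Require Import all_boot all_algebra.
From mathcomp Require Import boolp.
From mathcomp Require Import monalg.

Set Implicit Arguments.
Unset Strict Implicit.
Unset Printing Implicit Defensive.

Import GRing.Theory.
Local Open Scope ring_scope.
Local Open Scope quotient_scope.

(* An oriented graph on n vertices is given by its arrow relation
   [e : rel 'I_n], with [e i j] meaning i -> j. *)

Definition oriented_graph (n : nat) (e : rel 'I_n) : Prop :=
  irreflexive e /\ (forall i j, ~~ (e i j && e j i)).

Definition linked (n : nat) (e : rel 'I_n) : rel 'I_n :=
  fun i j => e i j || e j i.

Definition component (n : nat) (e : rel 'I_n) (i : 'I_n) : {set 'I_n} :=
  [set j | connect (linked e) i j].

(* The subgraph induced on V is v_1 -> ... -> v_m -> v_1 with m >= 3 distinct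
   vertices and no further arrows. *)
Definition is_oriented_cycle (n : nat) (e : rel 'I_n) (V : {set 'I_n}) : Prop :=
  exists c : seq 'I_n,
    [/\ (3 <= size c)%N, uniq c, V =i c
      & {in V &, forall x y, e x y = (y == next c x)}].

Definition is_acyclic (n : nat) (e : rel 'I_n) (V : {set 'I_n}) : Prop :=
  ~ exists c : seq 'I_n,
    [/\ (3 <= size c)%N, uniq c, {subset c <= V} & cycle e c].

(* The congruence on words over the vertices generated by the defining
   relations of the Hecke-Kiselman monoid. *)
Inductive hk_cong (n : nat) (e : rel 'I_n) : seq 'I_n -> seq 'I_n -> Prop :=
| hk_refl u : hk_cong e u u
| hk_sym u v : hk_cong e u v -> hk_cong e v u
| hk_trans u v w : hk_cong e u v -> hk_cong e v w -> hk_cong e u w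
| hk_cat u u' v v' :
    hk_cong e u u' -> hk_cong e v v' -> hk_cong e (u ++ v) (u' ++ v')
| hk_idem i : hk_cong e [:: i; i] [:: i]
| hk_comm i j : ~~ linked e i j -> hk_cong e [:: i; j] [:: j; i]
| hk_arrow_l i j : e i j -> hk_cong e [:: i; j; i] [:: i; j]
| hk_arrow_r i j : e i j -> hk_cong e [:: j; i; j] [:: i; j].

Definition hk_rel (n : nat) (e : rel 'I_n) : rel (seq 'I_n) :=
  fun u v => `[< hk_cong e u v >].

Section HeckeKiselman.
Variables (n : nat) (e : rel 'I_n).

Lemma hk_rel_refl : reflexive (hk_rel e).
Proof. by move=> u; apply/asboolP/hk_refl. Qed.

Lemma hk_rel_sym : symmetric (hk_rel e).
Proof. by move=> u v; apply/asboolP/asboolP; apply: hk_sym. Qed.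

Lemma hk_rel_trans : transitive (hk_rel e).
Proof.
by move=> v u w /asboolP uv /asboolP vw; apply/asboolP/(hk_trans uv vw).
Qed.

Canonical hk_equiv :=
  EquivRel (hk_rel e) hk_rel_refl hk_rel_sym hk_rel_trans.

Definition HK := {eq_quot hk_equiv}.
HB.instance Definition _ := Choice.on HK.
HB.instance Definition _ := Quotient.on HK.
HB.instance Definition _ := EqQuotient.on HK.

Definition HK_one : HK := \pi_HK [::].
Definition HK_mul (x y : HK) : HK := \pi_HK (repr x ++ repr y).

Lemma hk_piP u v : \pi_HK u = \pi_HK v <-> hk_cong e u v.
Proof.
split=> [/eqP|uv]; first by rewrite piE => /asboolP.
by apply/eqP; rewrite piE; apply/asboolP.
Qed.

Lemma HK_mulE u v : HK_mul (\pi_HK u) (\pi_HK v) = \pi_HK (u ++ v).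
Proof.
by apply/hk_piP/hk_cat; apply/hk_piP; rewrite reprK.
Qed.

Lemma HK_mulA : associative HK_mul.
Proof.
elim/quotW=> u; elim/quotW=> v; elim/quotW=> w.
by rewrite (HK_mulE v w) (HK_mulE u v) (HK_mulE u) (HK_mulE _ w) catA.
Qed.

Lemma HK_mul1 : left_id HK_one HK_mul.
Proof. by elim/quotW=> u; apply: HK_mulE. Qed.

Lemma HK_mulr1 : right_id HK_one HK_mul.
Proof. by elim/quotW=> u; rewrite HK_mulE cats0. Qed.

Lemma hk_cong_nil u v : hk_cong e u v -> nilp u = nilp v.
Proof.
elim=> //=; first by move=> ? ? ? _ -> _ ->.
by case=> [|? ?] [|? ?] [|? ?] [|? ?] //= _ _.
Qed.

Lemma HK_unit x y : HK_mul x y = HK_one -> x = HK_one /\ y = HK_one.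
Proof.
elim/quotW: x => u; elim/quotW: y => v; rewrite HK_mulE => /hk_piP/hk_cong_nil.
by case: u v => [|? ?] [|? ?].
Qed.

HB.instance Definition _ :=
  Choice_isMonomialDef.Build HK HK_mulA HK_mul1 HK_mulr1 HK_unit.

End HeckeKiselman.

Definition is_right_ideal (R : nzRingType) (I : R -> Prop) : Prop :=
  [/\ I 0, forall x y, I x -> I y -> I (x + y)
    & forall x a, I x -> I (x * a)].

Definition is_left_ideal (R : nzRingType) (I : R -> Prop) : Prop :=
  [/\ I 0, forall x y, I x -> I y -> I (x + y)
    & forall x a, I x -> I (a * x)].

Definition stabilizes (R : nzRingType) (I : nat -> R -> Prop) : Prop :=
  exists N, forall m, (N <= m)%N -> forall x, I m x <-> I N x.

Definition right_noetherian (R : nzRingType) : Prop :=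
  forall I : nat -> R -> Prop,
    (forall k, is_right_ideal (I k)) ->
    (forall k x, I k x -> I k.+1 x) -> stabilizes I.

Definition left_noetherian (R : nzRingType) : Prop :=
  forall I : nat -> R -> Prop,
    (forall k, is_left_ideal (I k)) ->
    (forall k x, I k x -> I k.+1 x) -> stabilizes I.

(* Main.v *)
Require Import Defs.
From mathcomp Require Import all_boot all_order all_algebra.
From mathcomp Require Import boolp.
From mathcomp Require Import finmap monalg.
From mathcomp Require Import zify.

Set Implicit Arguments.
Unset Strict Implicit.
Unset Printing Implicit Defensive.

Import Order.TTheory GRing.Theory Num.Theory.
Local Open Scope ring_scope.
Local Open Scope quotient_scope.

(** Reversing words turns left ideals into right ideals and reverses all arrows, which
    does not affect the condition on the components, so it is enough to decide when
    the algebra is right Noetherian.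

    Suppose first that every component is an oriented cycle or acyclic. For each
    component V, the span of the words over V is a finitely generated right module
    over K[y] for some element y of that span ([finite_over_poly]). Words over
    different components commute, so the components can be added one at a time,
    each time by Hilbert's basis argument ([noeth_adjoin], [noeth_glue]). If V is
    acyclic, it has a source s, and s t s = s t for all words t over V; hence there
    are only finitely many words up to congruence ([acyclic_words]) and y = 1 will
    do. If V is an oriented cycle with m vertices, lift its vertices to int and let
    the letter i send a function a on int to the function that takes the value
    a (k - 1) at every k above i and is equal to a elsewhere. Words are thereby
    identified with functions: the nonempty ones correspond to the nondecreasing
    functions with a (k + m) = a k + m and a k <= k that are not injective
    ([slides_faithful], [slides_surj]). On the span I of the nonempty words,
    subtracting m from the function is a linear operator t that commutes with
    multiplications, and I is finitely generated over K[t] ([turn_generated]).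
    The operator t need not be multiplication by an element of the algebra, and the
    main point is to replace it by one. Let u = 1 - prod_i (1 - x_i), an element of
    I. To lowest order, right multiplication by u is the identity of I, because
    every nonempty word absorbs its last letter; so it is injective
    ([letter_complements_regular]). As I is Noetherian over K[t], the powers of u
    satisfy a polynomial relation over K[t], and cancelling the lowest power of u
    gives p != 0 and y in I with p(t) x = x y for all x in I ([central_scalar]).
    Then I is finitely generated over K[y] ([cycle_finite_of_regular]).

    Conversely, suppose that some component contains a cycle without being an
    oriented cycle. A shortest cycle c has no chord, so it misses some vertex of
    the component, and a vertex v outside c is linked to a vertex x of c. The
    monoid acts on the right on vertex labellings whenever each letter recomputes
    the label of its vertex from the labels at the origins of the incoming arrows
    ([run_cong]). Let labels travel around c and grow by one at each passage
    through x. If x -> v, let v record the label of x, and identify states that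
    differ only by records up to k; if v -> x, let v stop the growth, and identify
    all stopped states with labels up to k. Either way one gets right congruences
    that grow strictly with k, hence right ideals that grow strictly with k
    ([not_right_noetherian], [neighbour_not_noetherian]). *)

(** * The words over an oriented cycle as functions on the integers *)

Section Cycle.
Variables (n : nat) (e : rel 'I_n) (c : seq 'I_n) (x0 : 'I_n).
Hypotheses (c_size : (3 <= size c)%N) (c_uniq : uniq c)
  (c_arrow : {in c &, forall x y, e x y = (y == next c x)}).

Local Notation m := (size c).
Local Notation "u ~~> v" := (hk_cong e u v) (at level 70).

(** The integers are unrolled around the cycle: [site k] is the vertex below [k]. *)
Definition site (k : int) : 'I_n := nth x0 c `|(k %% m%:Z)%Z|.

Let m_neq0 : m%:Z != 0.
Proof. by lia. Qed.

Let modz_abs (k : int) : `|(k %% m%:Z)%Z|%:Z = (k %% m%:Z)%Z.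
Proof. by rewrite gez0_abs // modz_ge0. Qed.

Let modz_lt (k : int) : (`|(k %% m%:Z)%Z| < m)%N.
Proof. by rewrite -ltz_nat modz_abs ltz_pmod //; lia. Qed.

Lemma site_mem k : site k \in c.
Proof. exact: mem_nth. Qed.

Lemma site_addm k : site (k + m%:Z) = site k.
Proof. by rewrite /site modzDr. Qed.

Lemma site_onto i : i \in c -> exists2 j, (j < m)%N & site j%:Z = i.
Proof.
move=> ic; exists (index i c); first by rewrite index_mem.
by rewrite /site modz_nat absz_nat modn_small ?index_mem ?nth_index.
Qed.

Lemma site_inj k l : site k = site l -> (k %% m%:Z)%Z = (l %% m%:Z)%Z.
Proof.
move/eqP; rewrite nth_uniq // => /eqP kl.
by rewrite -[LHS]modz_abs kl modz_abs.
Qed.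

Lemma site_next k : site (k + 1) = next c (site k).
Proof.
rewrite next_nth site_mem /site index_uniq //.
set r := `|(k %% m%:Z)%Z|%N.
have rm : (r < m)%N by apply: modz_lt.
have -> : ((k + 1) %% m%:Z)%Z = (r.+1 %% m)%N%:Z.
  by rewrite -modz_nat -addn1 PoszD modz_abs modzDml.
rewrite absz_nat; case: (c) c_size rm => //= y p _; rewrite ltnS leq_eqVlt.
case/orP => [/eqP -> | rp]; first by rewrite modnn /= nth_default.
by rewrite modn_small ?ltnS //=; apply: set_nth_default.
Qed.

Lemma site_prev k : next c (site (k - 1)) = site k.
Proof. by rewrite -site_next subrK. Qed.

Lemma site_neq k (d : nat) : (0 < d < m)%N -> site (k + d%:Z) != site k.
Proof.
move=> dm; apply/eqP => /site_inj /eqP.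
rewrite eqz_mod_dvd [X in X - _]addrC addrK dvdzE /= => /dvdn_leq; lia.
Qed.

Lemma next_neq i : i \in c -> next c i != i.
Proof.
case/site_onto=> j _ <-; rewrite -site_next; apply: (@site_neq _ 1); lia.
Qed.

Lemma next_next_neq i : i \in c -> next c (next c i) != i.
Proof.
case/site_onto=> j _ <-; rewrite -!site_next -addrA.
apply: (@site_neq _ 2); lia.
Qed.

Lemma next_arrow i : i \in c -> e i (next c i).
Proof. by move=> ic; rewrite c_arrow ?mem_next ?eqxx. Qed.

Lemma not_adjacent i j : i \in c -> j \in c -> j != next c i -> i != next c j ->
  ~~ linked e i j.
Proof. by move=> ic jc ij ji; rewrite /linked !c_arrow // negb_or ij ji. Qed.

Definition slide (i : 'I_n) (a : int -> int) (k : int) : int :=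
  if site k == i then a (k - 1) else a k.

Definition slides (w : seq 'I_n) : int -> int := foldl (fun a i => slide i a) id w.

Lemma slides_rcons w i : slides (rcons w i) = slide i (slides w).
Proof. by rewrite /slides -cats1 foldl_cat. Qed.

Lemma slide_out i a : i \notin c -> slide i a = a.
Proof.
move=> ic; apply/funext => k; rewrite /slide.
by case: eqP => // ki; rewrite -ki site_mem in ic.
Qed.

Lemma slide_comp i (a b : int -> int) : slide i (a \o b) = a \o slide i b.
Proof. by apply/funext => k; rewrite /slide /=; case: eqP. Qed.

Lemma foldl_slide w a : foldl (fun a i => slide i a) a w = a \o slides w.
Proof.
elim/last_ind: w => [|w i IH]; first by apply/funext.
by rewrite -cats1 foldl_cat /= IH slide_comp cats1 slides_rcons.
Qed.

Lemma slides_cat u v : slides (u ++ v) = slides u \o slides v.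
Proof. by rewrite /slides foldl_cat foldl_slide. Qed.

Lemma slide_idem i a : slide i (slide i a) = slide i a.
Proof.
apply/funext => k; rewrite /slide; case: eqP => // ki.
case: eqP => // ki'; have := next_neq (site_mem (k - 1)).
by rewrite site_prev ki ki' eqxx.
Qed.

Lemma slide_comm i j a : j != next c i -> i != next c j ->
  slide i (slide j a) = slide j (slide i a).
Proof.
have [<- //|ij jn ni] := eqVneq i j; apply/funext => k; rewrite /slide.
have hp := site_prev k.
have [ki|ki] := eqVneq (site k) i.
  rewrite ki (negPf ij); case: eqP => // kj.
  by rewrite -ki -hp kj eqxx in ni.
case: eqP => // kj; case: eqP => // ki'.
by rewrite -kj -hp ki' eqxx in jn.
Qed.

Lemma slide_arrow i a : i \in c ->
  slide i (slide (next c i) (slide i a)) = slide (next c i) (slide i a).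
Proof.
move=> ic; apply/funext => k; rewrite /slide.
have hp := site_prev k; have hn := next_neq ic; have hnn := next_next_neq ic.
have [ki|ki] := eqVneq (site k) i.
  have p1 : site (k - 1) != i.
    by apply: contraNneq hn => p; rewrite -{1}p hp ki.
  have p2 : site (k - 1) != next c i.
    by apply: contraNneq hnn => p; rewrite -p hp ki.
  by rewrite ki (negPf p1) (negPf p2) (eq_sym i) (negPf hn).
by [].
Qed.

Lemma slide_arrow_next i a : i \in c ->
  slide (next c i) (slide i (slide (next c i) a)) = slide (next c i) (slide i a).
Proof.
move=> ic; apply/funext => k; rewrite /slide.
have hp := site_prev k; have hp2 := site_prev (k - 1).
have hn := next_neq ic; have hnn := next_next_neq ic.
have [ki|ki] := eqVneq (site k) (next c i); last first.
  by case: eqP => // ki'; case: eqP => // ki''; rewrite -hp ki'' in ki'; rewrite ki' eqxx in hnn.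
have p1 : site (k - 1) = i by apply: (can_inj (prev_next c_uniq)); rewrite hp.
have p2 : site (k - 1 - 1) != next c i.
  by apply: contraNneq hnn => p; rewrite -p hp2 p1.
by rewrite p1 eqxx (negPf p2).
Qed.

(** A letter outside [c] acts as the identity, so the relations that involve it hold
    whatever its arrows are; only relations between two letters of [c] need the
    shape of the cycle. *)
Lemma slides_cong u v : u ~~> v -> slides u = slides v.
Proof.
have ext w : slides w = foldl (fun a i => slide i a) id w by [].
elim=> {u v} //.
- by move=> u v w _ -> _.
- by move=> u u' v v' _ uu' _ vv'; rewrite !slides_cat uu' vv'.
- by move=> i; rewrite /slides /= slide_idem.
- move=> i j ij; rewrite /slides /=.
  have [ic|/slide_out ic] := boolP (i \in c); last by rewrite !ic.
  have [jc|/slide_out jc] := boolP (j \in c); last by rewrite !jc.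
  by move: ij; rewrite /linked !c_arrow // negb_or => /andP[? ?]; rewrite slide_comm.
- move=> i j ij; rewrite /slides /=.
  have [ic|/slide_out ic] := boolP (i \in c); last by rewrite !ic.
  have [jc|/slide_out jc] := boolP (j \in c); last by rewrite !jc slide_idem.
  by move: ij; rewrite c_arrow // => /eqP ->; rewrite slide_arrow.
- move=> i j ij; rewrite /slides /=.
  have [ic|/slide_out ic] := boolP (i \in c); last by rewrite !ic slide_idem.
  have [jc|/slide_out jc] := boolP (j \in c); last by rewrite !jc.
  by move: ij; rewrite c_arrow // => /eqP ->; rewrite slide_arrow_next.
Qed.

(** The order-theoretic shape of all the functions [slides w]. *)
Record admissible (a : int -> int) : Prop := Admissible {
  adm_mono : forall k, a k <= a (k + 1);
  adm_per : forall k, a (k + m%:Z) = a k + m%:Z;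
  adm_reg : forall k, a k <= k }.

Lemma adm_pred a : admissible a -> forall k, a (k - 1) <= a k.
Proof. by move=> /adm_mono am k; have := am (k - 1); rewrite subrK. Qed.

Lemma adm_le a : admissible a -> forall k l, k <= l -> a k <= a l.
Proof.
move=> /adm_mono am k l kl; have -> : l = k + `|l - k|%N%:Z by lia.
elim: `|l - k|%N => [|d IH]; first by rewrite addr0.
by apply: (le_trans IH); rewrite -addn1 PoszD addrA.
Qed.

Lemma adm_perM a : admissible a -> forall (d : nat) k, a (k + (d * m)%N%:Z) = a k + (d * m)%N%:Z.
Proof.
move=> /adm_per ap; elim=> [|d IH] k; first by rewrite mul0n !addr0.
by rewrite mulSn PoszD (addrC m%:Z) !addrA ap IH.
Qed.

Lemma adm_id : admissible id.
Proof. by split=> k //; lia. Qed.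

Lemma slide_le i a : admissible a -> forall k, slide i a k <= a k.
Proof. by move=> /adm_pred ap k; rewrite /slide; case: ifP. Qed.

Lemma adm_slide i a : admissible a -> admissible (slide i a).
Proof.
move=> aa; split=> k; rewrite /slide.
- have hn := next_neq (site_mem k); rewrite -site_next in hn.
  rewrite addrK; case: (eqVneq (site k) i) => [ki|ki].
    by rewrite -ki (negPf hn); apply: (adm_le aa); lia.
  by case: ifP => _ //; apply: adm_mono.
- rewrite site_addm; case: ifP => _; last exact: adm_per.
  by rewrite addrAC adm_per.
- by apply: (le_trans (slide_le i aa k)); apply: adm_reg.
Qed.

Lemma adm_slides w : admissible (slides w).
Proof.
elim/last_ind: w => [|w i IH]; first exact: adm_id.
by rewrite slides_rcons; apply: adm_slide.
Qed.

(** A partial inverse of [slide i]: the values above [i] are raised as far as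
    monotonicity and the bound [a k <= k] allow. *)
Definition lift_at (i : 'I_n) (a : int -> int) (k : int) : int :=
  if site k == i then Order.min (a (k + 1)) k else a k.

Lemma lift_slide_same i a : lift_at i (slide i a) = lift_at i a.
Proof.
apply/funext => k; rewrite /lift_at /slide; case: eqP => // ki.
by rewrite site_next ki; have := next_neq (site_mem k); rewrite ki => /negPf ->.
Qed.

Lemma lift_slide_comm i j a : j != i -> j != next c i ->
  lift_at i (slide j a) = slide j (lift_at i a).
Proof.
move=> ji jn; apply/funext => k; rewrite /lift_at /slide.
have hn := site_next k; have hp := site_prev k.
have [ki|ki] := eqVneq (site k) i.
  by rewrite ki in hn; rewrite hn ki (eq_sym _ j) (negPf jn) (eq_sym _ j) (negPf ji).
case: eqP => // kj; case: eqP => // kp.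
by rewrite -kj -hp kp eqxx in jn.
Qed.

Lemma lift_slide_next i a : admissible a -> i \in c ->
  lift_at i (slide (next c i) a) = slide (next c i) a.
Proof.
move=> aa ic; apply/funext => k; rewrite /lift_at; case: eqP => // ki.
rewrite {1 2}/slide site_next ki eqxx addrK (eq_sym i) (negPf (next_neq ic)).
by apply/min_idPl/adm_reg.
Qed.

Definition word_over (w : seq 'I_n) := {subset w <= c}.

Lemma cong_catl w u v : u ~~> v -> w ++ u ~~> w ++ v.
Proof. exact/hk_cat/hk_refl. Qed.
Lemma cong_catr w u v : u ~~> v -> u ++ w ~~> v ++ w.
Proof. by move=> uv; apply: hk_cat => //; apply: hk_refl. Qed.

Lemma word_over_rcons w i : word_over (rcons w i) <-> word_over w /\ i \in c.
Proof.
split=> [h|[wc ic] j]; last by rewrite mem_rcons inE => /predU1P[->|/wc].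
by split=> [j jw|]; apply: h; rewrite mem_rcons inE ?jw ?orbT ?eqxx.
Qed.

(** If sliding at [i] has no effect after [w], the letter [i] can be erased. Look at
    the last letter [j] of [w]. Unless [j = i], the equality of the values at
    [k - 1] and [k], for [k] above [i], was already there before [j], so [i] is
    absorbed by what precedes [j]; and [i] passes over [j], by commutation or by an
    arrow relation. If [j] is the predecessor of [i], monotonicity forces [j] to be
    ineffective too. *)
Lemma absorb w i : word_over w -> i \in c ->
  slide i (slides w) = slides w -> rcons w i ~~> w.
Proof.
elim/last_ind: w i => [|w j IH] i.
  move=> _ ic h; exfalso.
  case: (site_onto ic) => k _ ki; have := congr1 (fun a => a k%:Z) h.
  by rewrite /slide /slides /= ki eqxx; lia.
rewrite word_over_rcons slides_rcons => -[wc jc] ic h.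
set b := slides w in IH h.
have ab : admissible b by apply: adm_slides.
clearbody b.
have [ij|ij] := eqVneq j i.
  by rewrite -!cats1 -catA ij; apply/cong_catl/hk_idem.
have [nj|nj] := eqVneq (next c j) i.
  have hb k : site k = i -> b (k - 1) = b k /\ b (k - 1 - 1) = b k.
    move=> ki; have := congr1 (fun a => a k) h.
    have pj : site (k - 1) = j.
      by apply: (can_inj (prev_next c_uniq)); rewrite site_prev ki nj.
    rewrite /slide ki eqxx pj eqxx (eq_sym i) (negPf ij) => hk.
    have h1 := adm_pred ab k; have := adm_pred ab (k - 1).
    by rewrite hk => h2; split=> //; apply/eqP; rewrite eq_le h1 h2.
  have wi : rcons w i ~~> w.
    apply: IH => //; apply/funext => k; rewrite /slide; case: eqP => // ki.
    have := hb _ ki; lia.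
  have wj : rcons w j ~~> w.
    apply: IH => //; apply/funext => k; rewrite /slide; case: eqP => // kj.
    have := hb (k + 1); rewrite site_next kj nj addrK => /(_ erefl); lia.
  apply: (hk_trans _ (hk_sym wj)); rewrite -!cats1.
  apply: (hk_trans (cong_catr [:: i] _)); last by rewrite cats1; exact: wi.
  by rewrite cats1.
have wi : rcons w i ~~> w.
  apply: IH => //; apply/funext => k; have := congr1 (fun a => a k) h.
  rewrite /slide; case: eqP => // ki.
  have -> : site (k - 1) == j = false.
    by apply/eqP => kj; rewrite -ki -(site_prev k) kj eqxx in nj.
  by rewrite ki (eq_sym i) (negPf ij).
have wij : rcons (rcons w i) j ~~> rcons w j by rewrite -[rcons w j]cats1 -cats1; apply: cong_catr.
apply: hk_trans wij.
have [jn|jn] := eqVneq j (next c i).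
  rewrite -!cats1 -!catA /=.
  apply: hk_trans (_ : w ++ [:: i; j; i] ~~> _); last first.
    by apply/cong_catl/hk_arrow_l; rewrite jn next_arrow.
  have := cong_catr [:: j; i] (hk_sym wi); rewrite -cats1 -catA; exact.
rewrite -!cats1 -!catA /=; apply/cong_catl/hk_comm/not_adjacent => //.
by rewrite eq_sym.
Qed.

(** Before a letter [i], a word can be replaced by one that has the largest possible
    values above [i]: this singles out a canonical predecessor of every function.
    It holds because lifting at [i] commutes with the slides at all letters other
    than [i], whose effect it erases, and [next c i], after which it does nothing. *)
Lemma pull_back u i : word_over u -> i \in c ->
  exists v, [/\ word_over v, slides v = lift_at i (slides u) & rcons u i ~~> rcons v i].
Proof.
move=> + ic; elim/last_ind: u => [|u j IH].
  move=> _; exists [::]; split=> //; last exact: hk_refl.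
  by apply/funext => k; rewrite /lift_at /slides /=; case: eqP => //; lia.
rewrite word_over_rcons slides_rcons => -[uc jc].
have [v [vc vE uv]] := IH uc.
have [->|ij] := eqVneq j i.
  exists v; rewrite lift_slide_same; split => //; apply: hk_trans uv.
  by rewrite -!cats1 -catA; apply/cong_catl/hk_idem.
have [jn|jn] := eqVneq j (next c i).
  exists (rcons u j); split; [by rewrite word_over_rcons| | exact: hk_refl].
  by rewrite slides_rcons jn lift_slide_next //; apply: adm_slides.
exists (rcons v j); split; first by rewrite word_over_rcons.
  by rewrite slides_rcons vE lift_slide_comm.
have [nj|nj] := eqVneq i (next c j).
  have eji : e j i by rewrite nj next_arrow.
  have h w : rcons (rcons w j) i ~~> rcons w i ++ [:: j; i].
    by rewrite -!cats1 -!catA /=; apply/cong_catl/hk_sym/hk_arrow_r.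
  apply: (hk_trans (h u)); apply: hk_trans (hk_sym (h v)).
  exact: cong_catr.
have h w : rcons (rcons w j) i ~~> rcons w i ++ [:: j].
  by rewrite -!cats1 -!catA /=; apply/cong_catl/hk_comm/not_adjacent.
apply: (hk_trans (h u)); apply: hk_trans (hk_sym (h v)).
exact: cong_catr.
Qed.

Lemma adm_mod a k : admissible a ->
  a k - k = a (k %% m%:Z)%Z - (k %% m%:Z)%Z.
Proof.
move=> aa; rewrite {1 2}(divz_eq k m%:Z); set r := (k %% m%:Z)%Z.
case: (k %/ m%:Z)%Z => d.
  by rewrite -PoszM [_%:Z + r]addrC (adm_perM aa); lia.
rewrite NegzE mulNr -PoszM.
have := adm_perM aa d.+1 (- (d.+1 * m)%N%:Z + r); rewrite addrAC addNr add0r => ->.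
by rewrite opprD opprK addrA.
Qed.

Lemma adm_site a k l (d : int) : admissible a -> site k = site l ->
  a (k + d) - k = a (l + d) - l.
Proof.
move=> aa /site_inj kl; have := adm_mod (k + d) aa; have := adm_mod (l + d) aa.
rewrite -(modzDml l) -(modzDml k) kl !opprD !addrA => <-.
by move/(congr1 (fun z => z + d)); rewrite !subrK.
Qed.

Definition displacement (a : int -> int) : nat := (\sum_(j < m) `|j%:Z - a j%:Z|)%N.

(** The differences [k - a k] are periodic, so two distinct admissible functions
    already differ on the window [0, m). *)
Lemma displacement_lt a b : admissible a -> admissible b -> (forall k, a k <= b k) ->
  a <> b -> (displacement b < displacement a)%N.
Proof.
move=> aa ab ale neq.
have [k kab] : exists k, a k != b k.
  apply: contrapT => h; apply/neq/funext => k; apply/eqP.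
  by apply: contrapT => /negP kab; apply: h; exists k.
pose j := Ordinal (modz_lt k).
have jab : a j%:Z < b j%:Z.
  rewrite lt_neqAle ale andbT /= modz_abs -(inj_eq (@addIr _ (- (k %% m%:Z)%Z))).
  by rewrite -!adm_mod // (inj_eq (@addIr _ _)).
rewrite /displacement (bigD1 j) //= [X in (_ < X)%N](bigD1 j) //= -addSn.
apply: leq_add.
  move: jab (adm_reg ab j); rewrite /=; lia.
apply: leq_sum => i _; have := ale i; have := adm_reg ab i; lia.
Qed.

Definition plateau (a : int -> int) : Prop := exists k, a (k - 1) = a k.

Lemma slides_plateau u : word_over u -> u <> [::] -> plateau (slides u).
Proof.
case/lastP: u => // u i /word_over_rcons[_ ic] _.
have [k _ ki] := site_onto ic; exists k%:Z.
have := congr1 (fun a => a k%:Z) (slide_idem i (slides u)).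
by rewrite slides_rcons {1}/slide ki eqxx.
Qed.

Lemma slides_id u : word_over u -> slides u = id -> u = [::].
Proof.
move=> uc uE; apply: contrapT => /(slides_plateau uc) [k].
by rewrite uE; lia.
Qed.

(** To the right of a plateau the function must increase again, since
    [a (k + m) = a k + m]. *)
Lemma plateau_end a : admissible a -> plateau a ->
  exists2 k, a (k - 1) = a k & a k < a (k + 1).
Proof.
move=> aa [k kk].
have [d dP] : exists d : nat, a (k + d%:Z) < a (k + d%:Z + 1).
  apply: contrapT => h.
  have cst (d : nat) : a (k + d%:Z) = a k.
    elim: d => [|d IH]; first by rewrite addr0.
    rewrite -IH -addn1 PoszD addrA; apply/eqP; rewrite eq_le (adm_mono aa) andbT.
    by rewrite leNgt; apply/negP => hd; apply: h; exists d.
  by have := cst m; rewrite (adm_per aa); lia.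
have ex : exists d : nat, a (k + d%:Z) < a (k + d%:Z + 1) by exists d.
case: (ex_minnP ex) => {ex dP} {}d dP dmin; exists (k + d%:Z) => //.
case: d dP dmin => [|d] dP dmin; first by rewrite addr0.
have := dmin d; rewrite -addn1 PoszD !addrA addrK.
have := adm_mono aa (k + d%:Z); rewrite le_eqVlt => /orP[/eqP //|h /(_ h)].
by rewrite addn1 ltnn.
Qed.

Lemma adm_lift i a : admissible a -> admissible (lift_at i a).
Proof.
move=> aa; split=> k; rewrite /lift_at.
- have hn := next_neq (site_mem k); rewrite -site_next in hn.
  have [ki|ki] := eqVneq (site k) i; first by rewrite -ki (negPf hn) ge_min lexx.
  case: eqP => _; last exact: adm_mono.
  rewrite le_min (le_trans (adm_mono aa _) (adm_mono aa _)) /=.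
  by have := adm_reg aa k; lia.
- rewrite site_addm; case: eqP => _; last exact: adm_per.
  by rewrite [k + m%:Z + 1]addrAC (adm_per aa) addr_minl.
- by case: eqP => _; [rewrite ge_min lexx orbT | apply: adm_reg].
Qed.

Lemma lift_ge i a k : admissible a -> a k <= lift_at i a k.
Proof.
move=> aa; rewrite /lift_at; case: eqP => // _.
by rewrite le_min adm_mono // adm_reg.
Qed.

Section PlateauEnd.
Variables (a : int -> int) (k : int).
Hypotheses (aa : admissible a) (ak : a (k - 1) = a k) (ak1 : a k < a (k + 1)).

Lemma slide_plateau : slide (site k) a = a.
Proof.
apply/funext => l; rewrite /slide; case: eqP => // kl.
apply: (@addIr _ (- l)); have := adm_site (-1) aa kl.
by have := adm_site 0 aa kl; rewrite !addr0 ak => ->.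
Qed.

Lemma slide_lift : slide (site k) (lift_at (site k) a) = a.
Proof.
rewrite -[RHS]slide_plateau; apply/funext => l; rewrite /slide /lift_at.
case: (eqVneq (site l) (site k)) => // lk; case: eqP => // lk1.
by have := next_neq (site_mem k); rewrite -{1}lk1 site_prev lk eqxx.
Qed.

Lemma lift_neq : a k < lift_at (site k) a k.
Proof.
by rewrite /lift_at eqxx lt_min ak1 -ak; have := adm_reg aa (k - 1); lia.
Qed.

Lemma displacement_lift : (displacement (lift_at (site k) a) < displacement a)%N.
Proof.
apply: displacement_lt => //; [exact: adm_lift | by move=> l; apply: lift_ge |].
by move=> aE; have := lift_neq; rewrite -aE ltxx.
Qed.
End PlateauEnd.

(** Both words absorb the letter [i] at the end of a plateau of their common function
    ([absorb]), and then both have, before that [i], the canonical predecessor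
    ([pull_back]); its displacement is smaller, so induction applies. *)
Lemma slides_faithful u v : word_over u -> word_over v -> slides u = slides v -> u ~~> v.
Proof.
have [d] := ubnP (displacement (slides u)); elim: d u v => // d IH u v ud uc vc uv.
have [u0|u0] := eqVneq u [::].
  move: uv; rewrite u0 => /esym/(slides_id vc) ->; exact: hk_refl.
have [k k1 k2] := plateau_end (adm_slides u) (slides_plateau uc (elimN eqP u0)).
have sk := slide_plateau (adm_slides u) k1.
have step w : word_over w -> slides w = slides u -> exists w',
    [/\ word_over w', slides w' = lift_at (site k) (slides u) & w ~~> rcons w' (site k)].
  move=> wc wu; have [w' [w'c w'E ww']] := pull_back wc (site_mem k).
  exists w'; rewrite w'E wu; split=> //; apply: hk_trans ww'.
  by apply/hk_sym/absorb; rewrite ?site_mem ?wu.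
have [u' [u'c u'E uu']] := step u uc erefl.
have [v' [v'c v'E vv']] := step v vc (esym uv).
apply: (hk_trans uu'); apply: hk_trans (hk_sym vv').
rewrite -!cats1; apply/cong_catr/IH; rewrite ?u'E ?v'E //.
have := displacement_lift (adm_slides u) k1 k2; lia.
Qed.

(** Lift the function at the end of a plateau and use induction on the displacement.
    If no plateau is left after lifting, the lifted function is strictly increasing
    and fixes a point, which forces it to be the identity. *)
Lemma slides_surj a : admissible a -> plateau a ->
  exists u, [/\ word_over u, u <> [::] & slides u = a].
Proof.
have [d] := ubnP (displacement a); elim: d a => // d IH a ad aa /(plateau_end aa) [k k1 k2].
have bd := displacement_lift aa k1 k2; have ab := adm_lift (site k) aa.
have ba := slide_lift aa k1.
have bk : lift_at (site k) a (k + 1) = a (k + 1).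
  by rewrite /lift_at site_next (negPf (next_neq (site_mem k))).
set b := lift_at _ _ in bd ab ba bk.
have [bp|bp] := pselect (plateau b).
  have [|u [uc _ ub]] := IH b _ ab bp; first by lia.
  exists (rcons u (site k)); split; last by rewrite slides_rcons ub.
    by rewrite word_over_rcons; split=> //; apply: site_mem.
  by case: (u).
exists [:: site k]; split=> //; first by move=> i; rewrite inE => /eqP ->; apply: site_mem.
rewrite -ba /slides /=; congr slide; apply/esym/funext => l.
have inc j : b j < b (j + 1).
  rewrite lt_neqAle adm_mono // andbT; apply/eqP => h; apply: bp; exists (j + 1).
  by rewrite addrK.
(* [b k] is the minimum of [a (k + 1)] and [k], and [b k < b (k + 1) = a (k + 1)]. *)
have bkk : b k = k.
  have := inc k; rewrite bk /b /lift_at eqxx minElt; case: ifP => // _.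
  by rewrite ltxx.
have bkd (j : nat) : b (k + j%:Z) = k + j%:Z.
  apply/eqP; rewrite eq_le adm_reg //=; elim: j => [|j Hj]; first by rewrite addr0 bkk.
  move: Hj (inc (k + j%:Z)); rewrite -addn1 PoszD addrA.
  by move: (b (k + j%:Z)) (b (k + j%:Z + 1)) => x y; lia.
have D : k <= l + (`|k - l| * m)%N%:Z.
  have := @leq_pmulr `|k - l|%N m ltac:(lia); move: (muln _ m) => t; lia.
have := bkd `|(l + (`|k - l| * m)%N%:Z - k)%R|%N; rewrite gez0_abs ?subr_ge0 //.
by rewrite (addrC k) subrK (adm_perM ab) => /addIr.
Qed.

Definition shiftz (z : int) (a : int -> int) (k : int) : int := a k + z.

Lemma shiftz_comp z a b : shiftz z a \o b = shiftz z (a \o b).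
Proof. by []. Qed.

Lemma comp_shiftm a b : admissible a -> a \o shiftz (- m%:Z) b = shiftz (- m%:Z) (a \o b).
Proof.
move=> aa; apply/funext => k; rewrite /shiftz /=.
by have := adm_per aa (b k - m%:Z); rewrite subrK => ->; rewrite addrK.
Qed.

Lemma adm_shift z a : admissible a -> (forall k, a k + z <= k) -> admissible (shiftz z a).
Proof.
move=> aa az; split=> k; rewrite /shiftz; first by rewrite lerD2r (adm_mono aa).
  by rewrite (adm_per aa) addrAC.
exact: az.
Qed.

Lemma slides_shift z u : word_over u -> u <> [::] -> (forall k, slides u k + z <= k) ->
  exists v, [/\ word_over v, v <> [::] & slides v = shiftz z (slides u)].
Proof.
move=> uc u0 uz; apply: slides_surj; first exact/adm_shift/uz/adm_slides.
by have [k ke] := slides_plateau uc u0; exists k; rewrite /shiftz ke.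
Qed.

(** Some position at distance less than [m] to the left of [l] lies above the same
    vertex as [k], hence has the same displacement as [k]. *)
Lemma adm_bounded a k : admissible a -> k - m%:Z < a k -> forall l, l - (2 * m)%N%:Z < a l.
Proof.
move=> aa ak l; pose r := ((l - k) %% m%:Z)%Z.
have r0 : 0 <= r by rewrite modz_ge0.
have rm : r < m%:Z by apply: ltz_pmod; lia.
have h : a (l - r) - (l - r) = a k - k.
  rewrite (adm_mod (l - r)) // (adm_mod k) //.
  suff -> : ((l - r) %% m%:Z)%Z = (k %% m%:Z)%Z by [].
  apply/eqP; rewrite eqz_mod_dvd addrAC; apply/dvdzP; exists ((l - k) %/ m%:Z)%Z.
  by rewrite {1}(divz_eq (l - k) m%:Z) addrK.
have := adm_le aa (k := l - r) (l := l); rewrite gerBl => /(_ r0); lia.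
Qed.

(** Up to shifts by multiples of [m] there are finitely many functions: as long as
    [a k <= k - m] everywhere, [a] is the shift of an admissible function of smaller
    displacement, and otherwise all differences [k - a k] are less than [2 * m]. *)
Lemma slides_fin : exists G : seq (seq 'I_n),
  {in G, forall g, word_over g /\ g <> [::]} /\
  forall u, word_over u -> u <> [::] ->
    exists g (d : nat), g \in G /\ slides u = shiftz (- (d * m)%N%:Z) (slides g).
Proof.
pose code u := [ffun j : 'I_m => inord `|j%:Z - slides u j%:Z| : 'I_(2 * m).+1].
pose P u := word_over u /\ u <> [::].
pose small u := exists k, k - m%:Z < slides u k.
have ex f : exists y, (exists u, [/\ P u, small u & code u = f]) ->
    [/\ P y, small y & code y = f].
  have [[u uP]|h] := pselect (exists u, [/\ P u, small u & code u = f]).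
    by exists u.
  by exists [::].
have [g gP] := boolp.choice ex.
have codeP u v : small u -> small v -> code u = code v -> slides u = slides v.
  move=> [k ku] [l lv] uv; apply/funext => j.
  apply: (@addIr _ (- j)); rewrite (adm_mod j (adm_slides u)) (adm_mod j (adm_slides v)).
  congr (_ - _).
  have := congr1 (fun f : {ffun 'I_m -> 'I_(2 * m).+1} => nat_of_ord (f (Ordinal (modz_lt j)))) uv.
  rewrite !ffunE /= modz_abs; set r := (j %% m%:Z)%Z.
  have := adm_bounded (adm_slides u) ku r; have := adm_bounded (adm_slides v) lv r.
  have := adm_reg (adm_slides u) r; have := adm_reg (adm_slides v) r.
  move: (slides u r) (slides v r) => x y h1 h2 h3 h4.
  by rewrite !inordK; lia.
exists [seq u <- [seq g f | f <- enum {ffun 'I_m -> 'I_(2 * m).+1}] | `[< P u >]].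
split=> [u|u]; first by rewrite mem_filter => /andP[/asboolP].
have [d] := ubnP (displacement (slides u)); elim: d u => // d IH u ud uc u0.
have [us|us] := pselect (small u).
  have [gu gs gc] := gP (code u) (ex_intro _ u (And3 (conj uc u0) us erefl)).
  exists (g (code u)), 0%N; split.
    by rewrite mem_filter map_f ?mem_enum // andbT; apply/asboolP.
  by rewrite (codeP _ _ us gs (esym gc)); apply/funext => k; rewrite /shiftz mul0n oppr0 addr0.
have [v [vc v0 vE]] : exists v, [/\ word_over v, v <> [::] & slides v = shiftz m%:Z (slides u)].
  apply: slides_shift => // k; rewrite -lerBrDr leNgt; apply/negP => h; apply: us.
  by exists k.
have uv : slides u = shiftz (- m%:Z) (slides v).
  by apply/funext => k; rewrite vE /shiftz addrK.
have [|h [d' [hG hE]]] := IH v _ vc v0.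
  suff: (displacement (slides v) < displacement (slides u))%N by lia.
  apply: displacement_lt; [exact: adm_slides|exact: adm_slides| |].
    by move=> k; rewrite vE /shiftz lerDl.
  by move=> /(congr1 (fun a => a 0)); rewrite vE /shiftz; lia.
exists h, d'.+1; split=> //; apply/funext => k.
by rewrite uv hE /shiftz mulSn PoszD opprD addrAC addrA.
Qed.

End Cycle.

(** * Spaces that are Noetherian under a set of operators *)

Section OperatorNoetherian.
Variables (K : fieldType) (V : lmodType K).
Implicit Types (Om : (V -> V) -> Prop) (B Q : V -> Prop) (J : nat -> V -> Prop).

Record subspace Q : Prop := Subspace {
  sub0 : Q 0;
  subD : forall x y, Q x -> Q y -> Q (x + y);
  subZ : forall a x, Q x -> Q (a *: x) }.

Definition stable_under Om Q := forall w x, Om w -> Q x -> Q (w x).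

(** The chains consist of subspaces of the ambient space and are compared on [B]
    only; this gives the Noetherian property of a submodule [B] without making [B] a
    type. *)
Definition noeth Om B := forall J,
  (forall k, subspace (J k)) -> (forall k, stable_under Om (J k)) ->
  (forall k x, J k x -> J k.+1 x) ->
  exists N, forall k x, (N <= k)%N -> B x -> J k x -> J N x.

Definition operators Om := forall w, Om w -> {morph w : x y / x + y}.

Lemma operator0 Om w : operators Om -> Om w -> w 0 = 0.
Proof. by move=> OmD Ow; apply: (@addIr _ (w 0)); rewrite -OmD // !add0r. Qed.

Lemma subB Q x y : subspace Q -> Q x -> Q y -> Q (x - y).
Proof. by move=> sQ Qx Qy; rewrite -scaleN1r; apply: (subD sQ) => //; apply: subZ. Qed.

Lemma sub_sum Q (I : Type) (r : seq I) (F : I -> V) : subspace Q ->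
  (forall i, Q (F i)) -> Q (\sum_(i <- r) F i).
Proof. by move=> sQ QF; elim/big_ind: _ => //; [apply: sub0 | apply: subD]. Qed.

Lemma chain_le J : (forall k x, J k x -> J k.+1 x) ->
  forall k l x, (k <= l)%N -> J k x -> J l x.
Proof.
move=> Jc k l x /subnK <-; elim: (l - k)%N => // d IH Jk.
by rewrite addSn; apply/Jc/IH.
Qed.

Lemma noeth_zero Om : noeth Om (fun x => x = 0).
Proof. by move=> J sJ _ _; exists 0%N => k x _ -> _; apply: sub0. Qed.

Lemma noeth_line Om g : noeth Om (fun x => exists a, x = a *: g).
Proof.
move=> J sJ _ Jc; have [[N gN]|gJ] := pselect (exists N, J N g).
  by exists N => k x _ [a ->] _; apply: (subZ (sJ N)).
exists 0%N => k x _ [a ->] Jk; have [->|a0] := eqVneq a 0; first by rewrite scale0r; apply: sub0.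
by case: gJ; exists k; rewrite -[g]scale1r -(mulVf a0) -scalerA; apply: (subZ (sJ k)).
Qed.

Lemma noeth_add Om B1 B2 : operators Om -> subspace B1 -> subspace B2 ->
  stable_under Om B1 -> stable_under Om B2 ->
  noeth Om B1 -> noeth Om B2 ->
  noeth Om (fun x => exists b1 b2, [/\ B1 b1, B2 b2 & x = b1 + b2]).
Proof.
move=> OmD sB1 sB2 tB1 tB2 n1 n2 J sJ tJ Jc.
have [N1 N1P] := n1 J sJ tJ Jc.
(* [L k] is the projection of [J k] to [B2]. *)
pose L k b := B2 b /\ exists2 b1, B1 b1 & J k (b1 + b).
have [|||N2 N2P] := n2 L.
- move=> k; split.
  + by split; [apply: sub0 | exists 0; rewrite ?addr0; apply: sub0].
  + move=> x y [Bx [x1 Bx1 Jx]] [By [y1 By1 Jy]]; split; first exact: (subD sB2).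
    exists (x1 + y1); first exact: (subD sB1).
    by rewrite addrACA; apply: (subD (sJ k)).
  + move=> a x [Bx [x1 Bx1 Jx]]; split; first exact: (subZ sB2).
    exists (a *: x1); first exact: (subZ sB1).
    by rewrite -scalerDr; apply: (subZ (sJ k)).
- move=> k w x Ow [Bx [x1 Bx1 Jx]]; split; first exact: tB2.
  by exists (w x1); [apply: tB1 | rewrite -(OmD _ Ow); apply: tJ].
- by move=> k x [Bx [x1 Bx1 Jx]]; split=> //; exists x1 => //; apply: Jc.
exists (maxn N1 N2) => k x; rewrite geq_max => /andP[k1 k2] [b1 [b2 [Bb1 Bb2 ->]]] Jx.
have [_ [b1' Bb1' J']] : L N2 b2 by apply: (N2P k) => //; split=> //; exists b1.
have J1 : J N1 (b1 - b1').
  apply: (N1P k) => //; first exact: subB.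
  have -> : b1 - b1' = b1 + b2 - (b1' + b2) by rewrite opprD addrACA subrr addr0.
  by apply: subB => //; apply: chain_le J'.
have -> : b1 + b2 = (b1 - b1') + (b1' + b2) by rewrite addrA subrK.
apply: subD => //; first by apply: (chain_le Jc _ J1); rewrite leq_maxl.
by apply: (chain_le Jc _ J'); rewrite leq_maxr.
Qed.

Lemma noeth_image Om B (h : V -> V) : {morph h : x y / x + y} -> scalable h ->
  (forall w x, Om w -> w (h x) = h (w x)) ->
  noeth Om B -> noeth Om (fun x => exists2 b, B b & x = h b).
Proof.
move=> hD hZ hw nB J sJ tJ Jc; have h0 : h 0 = 0 by rewrite -[X in h X](scale0r 0) hZ scale0r.
have [|||N NP] := nB (fun k x => J k (h x)).
- move=> k; split; first by rewrite h0; apply: sub0.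
  + by move=> x y Jx Jy; rewrite hD; apply: subD.
  + by move=> a x Jx; rewrite hZ; apply: (subZ (sJ k)).
- by move=> k w x Ow Jx; rewrite -hw //; apply: tJ.
- by move=> k x; apply: Jc.
by exists N => k _ Nk [b Bb ->]; apply: NP.
Qed.

(** The summands are predicates, whose membership in a list can only be expressed by
    [List.In]. *)
Fixpoint sumset (Bs : seq (V -> Prop)) (x : V) : Prop :=
  if Bs is B :: Bs' then exists b r, [/\ B b, sumset Bs' r & x = b + r] else x = 0.

Lemma sumset_subspace Bs : (forall B, List.In B Bs -> subspace B) -> subspace (sumset Bs).
Proof.
elim: Bs => [_|B Bs IH sB] /=; first by split=> // [x y -> ->|a x ->]; rewrite ?addr0 ?scaler0.
have sBs : subspace (sumset Bs) by apply: IH => C hC; apply: sB; right.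
have {}sB : subspace B by apply: sB; left.
split.
- by exists 0, 0; split; [apply: (sub0 sB) | apply: (sub0 sBs) | rewrite addr0].
- move=> x y [b [r [Bb Br ->]]] [b' [r' [Bb' Br' ->]]].
  by exists (b + b'), (r + r'); rewrite addrACA; split=> //; [apply: (subD sB) | apply: (subD sBs)].
- move=> a x [b [r [Bb Br ->]]].
  by exists (a *: b), (a *: r); rewrite scalerDr; split=> //; [apply: (subZ sB) | apply: (subZ sBs)].
Qed.

Lemma sumset_in Bs B x : (forall B, List.In B Bs -> subspace B) ->
  List.In B Bs -> B x -> sumset Bs x.
Proof.
elim: Bs => //= C Bs IH sB [->|hB] Bx.
  exists x, 0; rewrite addr0; split=> //.
  apply: (sub0 (Q := sumset Bs)); apply: sumset_subspace => D hD.
  by apply: sB; right.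
exists 0, x; rewrite add0r; split=> //.
  by apply: (sub0 (Q := C)); apply: sB; left.
by apply: IH => // D hD; apply: sB; right.
Qed.

Lemma sumset_stable Om Bs : operators Om ->
  (forall B, List.In B Bs -> stable_under Om B) -> stable_under Om (sumset Bs).
Proof.
move=> OmD; elim: Bs => [_|B Bs IH tB] w x Ow /=.
  by move=> ->; apply: operator0 Ow.
move=> [b [r [Bb Br ->]]]; exists (w b), (w r); rewrite OmD //; split=> //.
  by apply: (tB B _ w b Ow Bb); left.
by apply: IH Ow Br => C hC; apply: tB; right.
Qed.

Lemma noeth_sumset Om Bs : operators Om ->
  (forall B, List.In B Bs -> [/\ subspace B, stable_under Om B & noeth Om B]) ->
  noeth Om (sumset Bs).
Proof.
move=> OmD; elim: Bs => [_|B Bs IH hB]; first exact: noeth_zero.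
have [|sB tB nB] := hB B; first by left.
have h C : List.In C Bs -> [/\ subspace C, stable_under Om C & noeth Om C].
  by move=> hC; apply: hB; right.
apply: noeth_add => //.
- by apply: sumset_subspace => C /h[].
- by apply: sumset_stable => // C /h[].
- exact: IH.
Qed.

Section Hilbert.
Variables (Om Om' : (V -> V) -> Prop) (B : V -> Prop) (y : V -> V).
Hypotheses (OmD : operators Om) (sB : subspace B) (tB : stable_under Om B)
  (yD : {morph y : u v / u + v}) (yZ : scalable y)
  (yw : forall w x, Om w -> w (y x) = y (w x))
  (OmOm' : forall w, Om w -> Om' w) (Omy : Om' y).

Fixpoint below (d : nat) (x : V) : Prop :=
  if d is d'.+1 then exists b v, [/\ B b, below d' v & x = iter d' y b + v] else x = 0.

Definition adjoin x := exists d, below d x.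

Let y0 : y 0 = 0.
Proof. by rewrite -[X in y X](scale0r 0) yZ scale0r. Qed.

Let iterD d : {morph iter d y : u v / u + v}.
Proof. by move=> u v; elim: d => //= d ->. Qed.

Let iterZ d a u : iter d y (a *: u) = a *: iter d y u.
Proof. by elim: d => //= d ->; rewrite yZ. Qed.

Let iter0 d : iter d y 0 = 0.
Proof. by elim: d => //= d ->. Qed.

Let iterw d w x : Om w -> w (iter d y x) = iter d y (w x).
Proof. by move=> Ow; elim: d => //= d IH; rewrite yw // IH. Qed.

Lemma below_sub d : subspace (below d).
Proof.
elim: d => [|d IH] /=; first by split=> // [u v -> ->|a u ->]; rewrite ?addr0 ?scaler0.
split.
- by exists 0, 0; rewrite iter0 addr0; split=> //; [exact: (sub0 sB) | exact: (sub0 IH)].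
- move=> x z [b [v [Bb Fv ->]]] [b' [v' [Bb' Fv' ->]]].
  by exists (b + b'), (v + v'); rewrite iterD addrACA; split=> //; [apply: (subD sB) | apply: (subD IH)].
- move=> a x [b [v [Bb Fv ->]]].
  by exists (a *: b), (a *: v); rewrite iterZ scalerDr; split=> //; [apply: (subZ sB) | apply: (subZ IH)].
Qed.

Lemma below_stable d : stable_under Om (below d).
Proof.
move=> w x Ow; elim: d x => [|d IH] x /=.
  by move=> ->; apply: operator0 Ow.
move=> [b [v [Bb Fv ->]]]; exists (w b), (w v); rewrite OmD // iterw //.
by split=> //; [apply: tB | apply: IH].
Qed.

Lemma below_y d x : below d x -> below d.+1 (y x).
Proof.
elim: d x => [|d IH] x.
  by move=> ->; exists 0, 0; rewrite y0 addr0; split=> //; apply: (sub0 sB).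
move=> [b [v [Bb Fv ->]]]; exists b, (y v); rewrite yD; split=> //; exact: IH.
Qed.

Lemma below_leq d d' x : (d <= d')%N -> below d x -> below d' x.
Proof.
move/subnK <-; elim: (d' - d)%N => // k IH Fx.
rewrite addSn /=; exists 0, x; rewrite iter0 add0r; split=> //; [exact: (sub0 sB) | exact: IH].
Qed.

Lemma adjoin_subspace : subspace adjoin.
Proof.
split; first by exists 0%N.
- move=> x z [d Fx] [d' Fz]; exists (maxn d d'); apply: (subD (below_sub _)).
    by apply: below_leq Fx; rewrite leq_maxl.
  by apply: below_leq Fz; rewrite leq_maxr.
- by move=> a x [d Fx]; exists d; apply: (subZ (below_sub _)).
Qed.

Lemma adjoin_y x : adjoin x -> adjoin (y x).
Proof. by move=> [d Fx]; exists d.+1; apply: below_y. Qed.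

Lemma adjoin_base x : B x -> adjoin x.
Proof. by exists 1%N, x, 0; rewrite addr0. Qed.

(** Hilbert's basis argument. The coefficients [b] of the elements [y^d b + ...] of
    [J k] of degree at most [d] form an [Om]-stable subspace [L k d] of [B], which
    increases with [k] and with [d]. If [J k] and [J N] have the same [L k d] for all
    [d], they are equal, by induction on the degree. *)
Lemma noeth_adjoin : noeth Om B -> noeth Om' adjoin.
Proof.
move=> nB J sJ tJ Jc.
pose L k d b := B b /\ exists2 v, below d v & J k (iter d y b + v).
have LS k k' d b : (k <= k')%N -> L k d b -> L k' d b.
  by move=> kk' [Bb [v Fv Jv]]; split=> //; exists v => //; apply: (chain_le Jc kk').
have LSd k d d' b : (d <= d')%N -> L k d b -> L k d' b.
  move/subnK <-; elim: (d' - d)%N => // j IH /IH [Bb [v Fv Jv]]; split=> //.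
  by exists (y v); [apply: below_y | rewrite addSn /= -yD; apply: tJ].
have Lsub k d : subspace (L k d).
  split.
  + by split; [apply: sub0 | exists 0; rewrite ?iter0 ?addr0; apply: sub0 => //; apply: below_sub].
  + move=> x z [Bx [x1 Bx1 Jx]] [Bz [z1 Bz1 Jz]]; split; first exact: (subD sB).
    exists (x1 + z1); first exact: (subD (below_sub d)).
    by rewrite iterD addrACA; apply: (subD (sJ k)).
  + move=> a x [Bx [x1 Bx1 Jx]]; split; first exact: (subZ sB).
    exists (a *: x1); first by apply: (subZ (below_sub _)).
    by rewrite iterZ -scalerDr; apply: (subZ (sJ k)).
have Lst k d : stable_under Om (L k d).
  move=> w x Ow [Bx [v Fv Jv]]; split; first exact: tB.
  exists (w v); first exact: below_stable.
  by rewrite -iterw // -OmD //; apply: tJ => //; apply: OmOm'.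
(* The diagonal takes care of all the degrees beyond [N0], the remaining finitely
   many degrees are handled one by one. *)
have [|||N0 N0P] := nB (fun k => L k k) => //.
  by move=> k x /(LSd _ _ k.+1 _ (leqnSn k)); apply: LS.
have ex d : exists N, forall k x, (N <= k)%N -> B x -> L k d x -> L N d x.
  by apply: (nB (fun k => L k d)) => // k x; apply: LS.
have [f fP] := boolp.choice ex.
pose N := maxn N0 (\max_(d < N0) f d).
have key k d b : (N <= k)%N -> L k d b -> L N d b.
  move=> Nk Lb; have Bb : B b by case: Lb.
  have [dN|Nd] := ltnP d N0.
    have fN : (f d <= N)%N.
      by rewrite leq_max (@leq_bigmax _ (fun d : 'I_N0 => f d) (Ordinal dN)) orbT.
    by apply: (LS _ _ _ _ fN); apply: (fP _ k) => //; apply: leq_trans Nk.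
  apply: (LS N0); first exact: leq_maxl.
  apply: (LSd _ _ _ _ Nd); apply: (N0P (maxn k d)) => //.
    by rewrite leq_max Nd orbT.
  by apply: (LS k); rewrite ?leq_maxl //; apply: (LSd _ _ _ _ _ Lb); rewrite leq_maxr.
exists N => k x Nk [d Fx]; elim: d x Fx => [|d IH] x /=; first by move=> -> _; apply: sub0.
move=> [b [v [Bb Fv ->]]] Jx.
have [_ [v' Fv' Jv']] : L N d b by apply: (key k) => //; split=> //; exists v.
have -> : iter d y b + v = (v - v') + (iter d y b + v').
  by rewrite addrCA subrK.
apply: subD => //; apply: IH; first by apply: subB => //; apply: below_sub.
have -> : v - v' = iter d y b + v - (iter d y b + v') by rewrite opprD addrACA subrr add0r.
by apply: subB => //; apply: chain_le Jv'.
Qed.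
End Hilbert.

End OperatorNoetherian.

(** * Algebras spanned by words *)

(** The properties of the monoid algebra on which the proof rests: [X w] is the class
    of the word [w], and [cf w] is the coefficient functional at that class. *)
Record word_algebra (n : nat) (e : rel 'I_n) (K : fieldType) (A : lalgType K)
    (X : seq 'I_n -> A) (cf : seq 'I_n -> A -> K) : Prop := WordAlgebra {
  wa_nil : X [::] = 1;
  wa_cat : forall u v, X (u ++ v) = X u * X v;
  wa_cong : forall u v, hk_cong e u v -> X u = X v;
  wa_scaler : forall (a : K) (x y : A), a *: (x * y) = x * (a *: y);
  wa_cfD : forall w (x y : A), cf w (x + y) = cf w x + cf w y;
  wa_cfZ : forall w a (x : A), cf w (a *: x) = a * cf w x;
  wa_cfX : forall w u, cf w (X u) = (`[< hk_cong e w u >])%:R;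
  wa_supp : forall x (Q : A -> Prop), subspace Q ->
    (forall w, cf w x != 0 -> Q (X w)) -> Q x;
  wa_ext : forall (W : lmodType K) (f : seq 'I_n -> W),
    (forall u v, hk_cong e u v -> f u = f v) ->
    exists F : A -> W,
      [/\ {morph F : x y / x + y}, scalable F & forall w, F (X w) = f w] }.

Section Span.
Variables (n : nat) (e : rel 'I_n) (K : fieldType) (A : lalgType K).
Variables (X : seq 'I_n -> A) (cf : seq 'I_n -> A -> K).
Hypothesis wa : word_algebra e X cf.
Local Notation "u ~~> v" := (hk_cong e u v) (at level 70).
Implicit Types (P : seq 'I_n -> Prop) (Q : A -> Prop).

(** The second-order form of the linear span: a linear statement about the span is
    proved by checking it on words. *)
Definition spanned P (x : A) : Prop :=
  forall Q, subspace Q -> (forall w, P w -> Q (X w)) -> Q x.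

Lemma spanned_subspace P : subspace (spanned P).
Proof.
split; first by move=> Q sQ _; apply: (sub0 sQ).
- by move=> x y Px Py Q sQ QP; apply: (subD sQ); [apply: Px | apply: Py].
- by move=> a x Px Q sQ QP; apply: (subZ sQ); apply: Px.
Qed.

Lemma spanned_word P w : P w -> spanned P (X w).
Proof. by move=> Pw Q _; apply. Qed.

Lemma spanned_sub P P' x : (forall w, P w -> P' w) -> spanned P x -> spanned P' x.
Proof. by move=> PP' Px Q sQ QP; apply: Px => // w /PP'; apply: QP. Qed.

Lemma spanned_full x : spanned (fun _ => True) x.
Proof. by apply: (wa_supp wa (spanned_subspace _)) => w _; apply: spanned_word. Qed.

Lemma words_span Q x : subspace Q -> (forall w, Q (X w)) -> Q x.
Proof. by move=> sQ QX; apply: (wa_supp wa sQ) => w _; apply: QX. Qed.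

Lemma equalizer_subspace (W : lmodType K) (F G : A -> W) :
  {morph F : x y / x + y} -> scalable F -> {morph G : x y / x + y} -> scalable G ->
  subspace (fun x => F x = G x).
Proof.
move=> FD FZ GD GZ; split.
- by rewrite -(scale0r 0) FZ GZ !scale0r.
- by move=> x y hx hy; rewrite FD GD hx hy.
- by move=> a x hx; rewrite FZ GZ hx.
Qed.

Lemma mulr_subspacel Q z : subspace Q -> subspace (fun x => Q (x * z)).
Proof.
move=> sQ; split; first by rewrite mul0r; apply: (sub0 sQ).
- by move=> x y Qx Qy; rewrite mulrDl; apply: (subD sQ).
- by move=> a x Qx; rewrite -scalerAl; apply: (subZ sQ).
Qed.

Lemma mulr_subspacer Q z : subspace Q -> subspace (fun x => Q (z * x)).
Proof.
move=> sQ; split; first by rewrite mulr0; apply: (sub0 sQ).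
- by move=> x y Qx Qy; rewrite mulrDr; apply: (subD sQ).
- by move=> a x Qx; rewrite -(wa_scaler wa); apply: (subZ sQ).
Qed.

Lemma spanned_mul P1 P2 P x y : (forall u v, P1 u -> P2 v -> P (u ++ v)) ->
  spanned P1 x -> spanned P2 y -> spanned P (x * y).
Proof.
move=> P12 Px Py; apply: (Px (fun x => spanned P (x * y))).
  exact: (mulr_subspacel y (spanned_subspace P)).
move=> u Pu; apply: (Py (fun y => spanned P (X u * y))).
  exact: (mulr_subspacer (X u) (spanned_subspace P)).
by move=> v Pv; rewrite -(wa_cat wa); apply: spanned_word; apply: P12.
Qed.

Lemma cf0 w : cf w 0 = 0.
Proof. by rewrite -(scale0r 0) (wa_cfZ wa) mul0r. Qed.

Lemma cfB w x y : cf w (x - y) = cf w x - cf w y.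
Proof. by rewrite -scaleN1r (wa_cfD wa) (wa_cfZ wa) mulN1r. Qed.

Lemma spanned_cf P x w : spanned P x -> cf w x != 0 -> exists2 v, P v & w ~~> v.
Proof.
move=> Px; apply: (Px (fun x => cf w x != 0 -> exists2 v, P v & w ~~> v)).
  split; first by rewrite cf0 eqxx.
  - move=> y z hy hz; rewrite (wa_cfD wa); have [->|/hy //] := eqVneq (cf w y) 0.
    by rewrite add0r.
  - move=> a y hy; rewrite (wa_cfZ wa); have [->|/hy //] := eqVneq (cf w y) 0.
    by rewrite mulr0 eqxx.
move=> v Pv; rewrite (wa_cfX wa); case: asboolP => [wv _|_]; last by rewrite eqxx.
by exists v.
Qed.

Lemma cf_inj x : (forall w, cf w x = 0) -> x = 0.
Proof.
move=> h; apply: (wa_supp wa (Q := fun x => x = 0)).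
  by split=> // [y z -> ->|a y ->]; rewrite ?addr0 ?scaler0.
by move=> w; rewrite h eqxx.
Qed.

Lemma cong_mem u v : u ~~> v -> u =i v.
Proof.
elim=> {u v} //.
- by move=> u v _ uv x; rewrite uv.
- by move=> u v w _ uv _ vw x; rewrite uv vw.
- by move=> u u' v v' _ uu' _ vv' x; rewrite !mem_cat uu' vv'.
- by move=> i x; rewrite !inE orbb.
- by move=> i j _ x; rewrite !inE orbC.
- by move=> i j _ x; rewrite !inE; case: (x == i); case: (x == j).
- by move=> i j _ x; rewrite !inE; case: (x == i); case: (x == j).
Qed.

End Span.

Section PolyAction.
Variables (K : fieldType) (V : lmodType K) (t : V -> V).
Hypotheses (tD : {morph t : x y / x + y}) (tZ : scalable t).

(** The [K[X]]-module structure in which the indeterminate acts as [t]. *)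
Definition poly_act (p : {poly K}) (x : V) : V := \sum_(i < size p) p`_i *: iter i t x.

Lemma poly_actE N (p : {poly K}) (x : V) : (size p <= N)%N -> poly_act p x = \sum_(i < N) p`_i *: iter i t x.
Proof.
move=> pN; rewrite /poly_act (big_ord_widen _ (fun i => p`_i *: iter i t x) pN) big_mkcond.
apply: eq_bigr => i _ /=; case: (ltnP i (size p)) => // pi.
by rewrite nth_default // scale0r.
Qed.

Lemma poly_actD p q x : poly_act (p + q) x = poly_act p x + poly_act q x.
Proof.
pose N := maxn (size p) (size q).
rewrite (@poly_actE N p) ?leq_maxl // (@poly_actE N q) ?leq_maxr // (@poly_actE N) ?size_polyD //.
by rewrite -big_split; apply: eq_bigr => i _; rewrite coefD scalerDl.
Qed.

Lemma poly_actZ a p x : poly_act (a *: p) x = a *: poly_act p x.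
Proof.
rewrite (@poly_actE (size p)) ?size_scale_leq // scaler_sumr.
by apply: eq_bigr => i _; rewrite coefZ scalerA.
Qed.

Lemma poly_act0 x : poly_act 0 x = 0.
Proof. by rewrite /poly_act size_poly0 big_ord0. Qed.

Lemma poly_actC a x : poly_act a%:P x = a *: x.
Proof. by rewrite (@poly_actE 1) ?size_polyC_leq1 // big_ord1 coefC. Qed.

Let t0 : t 0 = 0.
Proof. by rewrite -[X in t X](scale0r 0) tZ scale0r. Qed.

Lemma t_sum (I : Type) (r : seq I) (F : I -> V) :
  t (\sum_(i <- r) F i) = \sum_(i <- r) t (F i).
Proof. exact: (big_morph t tD t0). Qed.

Lemma poly_actX p x : poly_act ('X * p) x = t (poly_act p x).
Proof.
rewrite (@poly_actE (size p).+1); last first.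
  by have [->|p0] := eqVneq p 0; rewrite ?mulr0 ?size_poly0 // mulrC size_mulX.
rewrite big_ord_recl coefXM eqxx scale0r add0r t_sum.
by apply: eq_bigr => i _; rewrite tZ coefXM /=.
Qed.

Lemma poly_act_stable (Q : V -> Prop) p x : subspace Q -> (forall z, Q z -> Q (t z)) ->
  Q x -> Q (poly_act p x).
Proof.
move=> sQ Qt Qx; apply: (sub_sum _ sQ) => i; apply: (subZ sQ).
by elim: (i : nat) => //= j; apply: Qt.
Qed.
End PolyAction.

(** * The algebra of an oriented cycle *)

Section FiniteOverPolynomials.
Variables (n : nat) (K : fieldType) (A : lalgType K) (X : seq 'I_n -> A).

(** The right [K[y]]-submodule generated by [G]. *)
Definition generated (G : A -> Prop) (y : A) (x : A) : Prop :=
  forall Q : A -> Prop, subspace Q -> (forall g, G g -> Q g) ->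
    (forall z, Q z -> Q (z * y)) -> Q x.

Definition finite_over_poly (c : {pred 'I_n}) : Prop := exists (G : seq A) (y : A),
  [/\ {in G, forall g, spanned X (fun w => {subset w <= c}) g},
      spanned X (fun w => {subset w <= c}) y &
      forall w, {subset w <= c} -> generated (fun g => g \in G) y (X w)].
End FiniteOverPolynomials.

Section CycleAlgebra.
Variables (n : nat) (e : rel 'I_n) (K : fieldType) (A : lalgType K).
Variables (X : seq 'I_n -> A) (cf : seq 'I_n -> A -> K).
Hypothesis wa : word_algebra e X cf.
Variables (c : seq 'I_n) (x0 : 'I_n).
Hypotheses (c_size : (3 <= size c)%N) (c_uniq : uniq c)
  (c_arrow : {in c &, forall x y, e x y = (y == next c x)}).
Local Notation m := (size c).
Local Notation "u ~~> v" := (hk_cong e u v) (at level 70).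
Local Notation site := (site c x0).
Local Notation slide := (slide c x0).
Local Notation slides := (slides c x0).
Local Notation word_over := (word_over c).

Definition proper (w : seq 'I_n) : Prop := word_over w /\ w <> [::].

Local Notation I := (spanned X proper).

Let sI : subspace I.
Proof. exact: spanned_subspace. Qed.

Let faithful u v : word_over u -> word_over v -> slides u = slides v -> u ~~> v.
Proof. exact: slides_faithful. Qed.

Lemma proper_cong u v : u ~~> v -> proper u -> proper v.
Proof.
move=> uv [uc u0]; split; first by move=> i; rewrite -(cong_mem uv); apply: uc.
by move=> v0; apply: u0; have := hk_cong_nil uv; rewrite v0; case: (u).
Qed.

Lemma proper_cat u v : proper u -> proper v -> proper (u ++ v).
Proof.
move=> [uc u0] [vc v0]; split; last by case: (u) u0.
by move=> i; rewrite mem_cat => /orP[/uc|/vc].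
Qed.

Lemma I_mul x y : I x -> I y -> I (x * y).
Proof. by apply: (spanned_mul wa) => u v; apply: proper_cat. Qed.

(** Subtracting [m] from a function moves every value once around the cycle. It
    preserves the functions of nonempty words, but not the function of the empty
    word, because a shift is injective; so [t] is prescribed on nonempty words only. *)
Lemma full_turn_ex : exists t : A -> A,
  [/\ {morph t : x y / x + y}, scalable t &
      forall u, proper u -> exists v, [/\ proper v, t (X u) = X v &
        slides v = shiftz (- m%:Z) (slides u)]].
Proof.
have ex u : exists v, proper u -> proper v /\ slides v = shiftz (- m%:Z) (slides u).
  have [pu|?] := pselect (proper u); last by exists [::].
  have [|v [vc v0 vE]] := slides_shift (x0 := x0) (z := - m%:Z) c_size c_uniq pu.1 pu.2.
    move=> k; have := adm_reg (adm_slides x0 c_size c_uniq u) k; lia.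
  by exists v.
have [f fP] := boolp.choice ex.
have [u v uv|t [tD tZ tX]] := wa_ext wa (f := fun u => X (if `[< proper u >] then f u else u)).
  apply: (wa_cong wa); case: asboolP => pu; case: asboolP => pv //.
  - have [[fuc fu0] fuE] := fP _ pu; have [[fvc fv0] fvE] := fP _ pv.
    apply: faithful => //.
    by rewrite fuE fvE; congr shiftz; apply: (slides_cong (e := e)).
  - by case: pv; apply: (proper_cong uv).
  - by case: pu; apply: (proper_cong (hk_sym uv)).
exists t; split=> // u pu; have [pf fE] := fP _ pu; exists (f u); split=> //.
by rewrite tX; case: asboolP.
Qed.

Section FullTurn.
Variable t : A -> A.
Hypotheses (tD : {morph t : x y / x + y}) (tZ : scalable t)
  (tX : forall u, proper u -> exists v, [/\ proper v, t (X u) = X v &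
        slides v = shiftz (- m%:Z) (slides u)]).

Local Notation poly_act := (poly_act t).

Lemma turn_I x : I x -> I (t x).
Proof.
move=> Ix; apply: (Ix (fun x => I (t x))).
  split; first by rewrite -[Z in t Z](scale0r 0) tZ scale0r; apply: (sub0 sI).
  - by move=> y z; rewrite tD; apply: (subD sI).
  - by move=> a y; rewrite tZ; apply: (subZ sI).
by move=> u /tX[v [pv -> _]]; apply: spanned_word.
Qed.

(** On functions, this says that a translation by [m] passes through a composition,
    on the left for trivial reasons and on the right by periodicity. *)
Lemma turn_mul x y : I x -> I y -> t (x * y) = t x * y /\ t (x * y) = x * t y.
Proof.
move=> Ix Iy.
have key u v : proper u -> proper v -> t (X u * X v) = t (X u) * X v /\
    t (X u * X v) = X u * t (X v).
  move=> pu pv; have [u' [pu' -> u'E]] := tX pu; have [v' [pv' -> v'E]] := tX pv.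
  have [uv [puv tuv uvE]] := tX (proper_cat pu pv).
  rewrite -!(wa_cat wa) tuv; split; apply: (wa_cong wa); apply: faithful => //;
    rewrite ?uvE ?slides_cat ?u'E ?v'E ?shiftz_comp //.
  - exact: puv.1.
  - exact: (proper_cat pu' pv).1.
  - exact: puv.1.
  - exact: (proper_cat pu pv').1.
  - by rewrite comp_shiftm //; apply: adm_slides.
split.
- apply: (Ix (fun x => t (x * y) = t x * y)).
    apply: equalizer_subspace.
    + by move=> a b; rewrite mulrDl tD.
    + by move=> a b; rewrite -scalerAl tZ.
    + by move=> a b; rewrite tD mulrDl.
    + by move=> a b; rewrite tZ -scalerAl.
  move=> u pu; apply: (Iy (fun y => t (X u * y) = t (X u) * y)).
    apply: equalizer_subspace.
    + by move=> a b; rewrite mulrDr tD.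
    + by move=> a b; rewrite -(wa_scaler wa) tZ.
    + by move=> a b; rewrite mulrDr.
    + by move=> a b; rewrite -(wa_scaler wa).
  by move=> v pv; have [] := key u v pu pv.
- apply: (Ix (fun x => t (x * y) = x * t y)).
    apply: equalizer_subspace.
    + by move=> a b; rewrite mulrDl tD.
    + by move=> a b; rewrite -scalerAl tZ.
    + by move=> a b; rewrite mulrDl.
    + by move=> a b; rewrite -scalerAl.
  move=> u pu; apply: (Iy (fun y => t (X u * y) = X u * t y)).
    apply: equalizer_subspace.
    + by move=> a b; rewrite mulrDr tD.
    + by move=> a b; rewrite -(wa_scaler wa) tZ.
    + by move=> a b; rewrite tD mulrDr.
    + by move=> a b; rewrite tZ -(wa_scaler wa).
  by move=> v pv; have [] := key u v pu pv.
Qed.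

Lemma poly_act_I p x : I x -> I (poly_act p x).
Proof. exact: (poly_act_stable _ sI turn_I). Qed.

Lemma iter_turn_I k x : I x -> I (iter k t x).
Proof. by move=> Ix; elim: k => //= k; apply: turn_I. Qed.

Lemma iter_turn_mul k x y : I x -> I y ->
  iter k t x * y = iter k t (x * y) /\ x * iter k t y = iter k t (x * y).
Proof.
move=> Ix Iy; elim: k => //= k [IH1 IH2].
have [<- _] := turn_mul (iter_turn_I k Ix) Iy.
have [_ <-] := turn_mul Ix (iter_turn_I k Iy).
by rewrite IH1 IH2.
Qed.

Lemma poly_act_mul p x y : I x -> I y ->
  poly_act p x * y = poly_act p (x * y) /\ x * poly_act p y = poly_act p (x * y).
Proof.
move=> Ix Iy; rewrite /poly_act mulr_suml mulr_sumr; split; apply: eq_bigr => i _.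
  by rewrite -scalerAl (iter_turn_mul i Ix Iy).1.
by rewrite -(wa_scaler wa) (iter_turn_mul i Ix Iy).2.
Qed.

Lemma iter_turn_word k u : proper u -> exists v, [/\ proper v, iter k t (X u) = X v &
  slides v = shiftz (- (k * m)%N%:Z) (slides u)].
Proof.
move=> pu; elim: k => [|k [v [pv vX vE]]].
  by exists u; split=> //; apply/funext => l; rewrite /shiftz mul0n oppr0 addr0.
have [w [pw wX wE]] := tX pv; exists w; split=> //; first by rewrite /= vX.
by rewrite wE vE; apply/funext => l; rewrite /shiftz mulSn PoszD opprD addrAC addrA.
Qed.

Lemma turn_generated : exists G : seq (seq 'I_n), (forall g, g \in G -> proper g) /\
  forall Q : A -> Prop, subspace Q -> (forall g k, g \in G -> Q (iter k t (X g))) ->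
    forall x, I x -> Q x.
Proof.
have [G [GP GE]] := slides_fin x0 c_size c_uniq; exists G; split=> [g /GP //|Q sQ QG x Ix].
apply: Ix => // u pu; have [g [k [gG gE]]] := GE u pu.1 pu.2.
have [v [pv vX vE]] := iter_turn_word k (GP g gG).
suff -> : X u = iter k t (X g) by apply: QG.
rewrite vX; apply: (wa_cong wa); apply: faithful => //;
  [exact: pu.1 | exact: pv.1 | by rewrite gE vE].
Qed.

(** [I] is obtained from a finite-dimensional space by adjoining the operator [t]. *)
Lemma noeth_turn : noeth (fun w => w = t) I.
Proof.
have [G [GP Ggen]] := turn_generated.
pose Om := fun _ : A -> A => False.
pose B := sumset [seq (fun x => exists a : K, x = a *: X g) | g <- G].
have line_sub g : subspace (fun x => exists a : K, x = a *: X g).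
  split; first by exists 0; rewrite scale0r.
  - by move=> x y [a ->] [b ->]; exists (a + b); rewrite scalerDl.
  - by move=> a x [b ->]; exists (a * b); rewrite scalerA.
have linesP C : List.In C [seq (fun x => exists a : K, x = a *: X g) | g <- G] ->
    subspace C /\ noeth Om C.
  elim: (G) => //= g G' IH [<-|/IH //]; split; [exact: line_sub | exact: noeth_line].
have OmD : operators Om by [].
have nB : noeth Om B by apply: noeth_sumset => // C /linesP[sC nC]; split.
have sB : subspace B by apply: sumset_subspace => C /linesP[].
have nadj : noeth (fun w => w = t) (adjoin B t) by apply: (noeth_adjoin (Om := Om)).
move=> J sJ tJ Jc; have [N NP] := nadj J sJ tJ Jc; exists N => k x Nk Ix.
apply: NP => //; apply: (Ggen _ _ _ x Ix); first exact: adjoin_subspace.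
move=> g k' gG; elim: k' => [|k' IH]; last exact: adjoin_y.
apply: adjoin_base; rewrite //=.
apply: (@sumset_in _ _ _ (fun x => exists a : K, x = a *: X g)).
- by move=> C /linesP[].
- elim: (G) gG => //= g' G' IH; rewrite inE => /orP[/eqP ->|/IH]; [by left | by right].
- by exists 1; rewrite scale1r.
Qed.

(** The subspaces [L k], the sums of the [K[t] u^(j+1)] for [j < k], form an ascending
    chain of [K[t]]-submodules of [I]. Where it stops, the next power of [u] belongs
    to [L N]. *)
Lemma power_relation u : I u -> exists (N : nat) (q : nat -> {poly K}),
  (exists2 j, (j < N)%N & q j != 0) /\ \sum_(j < N) poly_act (q j) (u ^+ j.+1) = 0.
Proof.
move=> Iu; have Iu1 j : I (u ^+ j.+1).
  by elim: j => // j IH; rewrite exprS; apply: I_mul.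
pose L k x := exists q : nat -> {poly K}, x = \sum_(j < k) poly_act (q j) (u ^+ j.+1).
have [|||N NP] := noeth_turn (J := L).
- move=> k; split.
  + by exists (fun _ => 0); rewrite big1 // => j _; rewrite poly_act0.
  + move=> x y [p ->] [q ->]; exists (fun j => p j + q j).
    by rewrite -big_split; apply: eq_bigr => j _; rewrite poly_actD.
  + move=> a x [p ->]; exists (fun j => a *: p j).
    by rewrite scaler_sumr; apply: eq_bigr => j _; rewrite poly_actZ.
- move=> k _ x -> [p ->]; exists (fun j => 'X * p j).
  by rewrite t_sum //; apply: eq_bigr => j _; rewrite poly_actX.
- move=> k x [p ->]; exists (fun j => if (j < k)%N then p j else 0).
  rewrite big_ord_recr /= ltnn poly_act0 addr0; apply: eq_bigr => j _.
  by rewrite ltn_ord.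
have [|p pE] := NP N.+1 (u ^+ N.+1) (leqnSn N) (Iu1 N).
  exists (fun j => (j == N)%:R%:P); rewrite big_ord_recr /= eqxx poly_actC scale1r.
  rewrite big1 ?add0r // => j _.
  by rewrite (ltn_eqF (ltn_ord j)) poly_act0.
exists N.+1, (fun j => if (j < N)%N then p j else (-1)%:P); split.
  by exists N; rewrite // ltnn polyC_eq0 oppr_eq0 oner_eq0.
rewrite big_ord_recr /= ltnn poly_actC scaleN1r.
apply/eqP; rewrite subr_eq0 pE; apply/eqP; apply: eq_bigr => j _.
by rewrite ltn_ord.
Qed.

(** Multiply [x] by the relation between powers of [u], transfer the coefficients from
    the powers of [u] to [x], and cancel the lowest power of [u] on the right: the
    lowest coefficient [p] then acts on [x] as right multiplication by an element of
    [I] that does not depend on [x]. *)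
Lemma central_scalar u : I u -> (forall x, I x -> x * u = 0 -> x = 0) ->
  exists (p : {poly K}) (y : A), [/\ p != 0, I y & forall x, I x -> poly_act p x = x * y].
Proof.
move=> Iu u_reg; have [N [q [ex qE]]] := power_relation Iu.
have ex' : exists j, (j < N)%N && (q j != 0) by case: ex => j jN qj; exists j; rewrite jN.
case: (ex_minnP ex') => j0 /andP[j0N qj0] jmin.
have Iu1 j : I (u ^+ j.+1).
  by elim: j => // j IH; rewrite exprS; apply: I_mul.
have u_regX k x : I x -> x * u ^+ k = 0 -> x = 0.
  elim: k => [|k IH] Ix; first by rewrite mulr1.
  by rewrite exprSr mulrA => /u_reg h; apply: IH => //; apply: h; case: (k) => [|k']; rewrite ?mulr1 //; apply: I_mul.
(* [j0] is the index of the lowest power with nonzero coefficient. *)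
have [D ND] : exists D, N = (j0 + D.+1)%N by exists (N - j0.+1)%N; lia.
pose y := - \sum_(i < D) poly_act (q (j0 + i.+1)%N) (u ^+ i.+1).
have Iy : I y.
  rewrite /y -scaleN1r; apply: (subZ sI); apply: (sub_sum _ sI) => i; exact: poly_act_I.
exists (q j0), y; split=> // x Ix.
pose S := poly_act (q j0) x + \sum_(i < D) poly_act (q (j0 + i.+1)%N) x * u ^+ i.+1.
have IS : I S.
  apply: (subD sI); first exact: poly_act_I.
  by apply: (sub_sum _ sI) => i; apply: I_mul => //; apply: poly_act_I.
have S0 : S = 0.
  apply: (u_regX j0.+1) => //.
  have := congr1 (fun z => x * z) qE; rewrite mulr0 ND big_split_ord /=.
  rewrite [X in X + _]big1 => [|j _]; last first.
    have -> : q j = 0; last by rewrite poly_act0.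
    apply/eqP; apply: contraT => qj; have := jmin j; rewrite qj ND; have := ltn_ord j; lia.
  rewrite add0r big_ord_recl /= addn0 mulrDr [x * (\sum_(i < D) _)]mulr_sumr.
  rewrite /S mulrDl [(\sum_(i < D) _) * _]mulr_suml => h.
  rewrite -[RHS]h; congr (_ + _).
    by rewrite (poly_act_mul _ Ix (Iu1 j0)).1 (poly_act_mul _ Ix (Iu1 j0)).2.
  apply: eq_bigr => i _; rewrite -mulrA -exprD /bump /= add1n.
  have -> : (i.+1 + j0.+1 = (j0 + i.+1).+1)%N by lia.
  by rewrite (poly_act_mul _ Ix (Iu1 _)).1 (poly_act_mul _ Ix (Iu1 _)).2.
move: S0 => /eqP; rewrite addr_eq0 => /eqP ->; rewrite /y mulrN mulr_sumr; congr (- _).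
by apply: eq_bigr => i _; rewrite (poly_act_mul _ Ix (Iu1 _)).1 (poly_act_mul _ Ix (Iu1 _)).2.
Qed.

(** The element used is [t y] rather than [y]: it acts on [I] as [X p], a polynomial
    of degree [D = size p > 0]. Hence [t^D x] is a combination of [x * t y] and of
    [t^i x] for [i < D], and the [t^k g] with [k < D], for [g] in a finite generating
    set over [K[t]], generate [I] over [K[t y]]. *)
Lemma cycle_finite_of_regular u : I u -> (forall x, I x -> x * u = 0 -> x = 0) ->
  finite_over_poly X [pred i | i \in c].
Proof.
move=> Iu u_reg; have [p [y [p0 Iy py]]] := central_scalar Iu u_reg.
have [G [GP Ggen]] := turn_generated.
pose D := size p.
have spanI x : I x -> spanned X (fun w => {subset w <= [pred i | i \in c]}) x.
  by apply: spanned_sub => w [].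
exists (1 :: [seq iter k t (X g) | g <- G, k <- iota 0 D]), (t y); split.
- move=> z; rewrite inE => /orP[/eqP ->|].
    by rewrite -(wa_nil wa); apply: spanned_word.
  by case/allpairsP => -[g k] /= [gG _ ->]; apply: spanI; apply: iter_turn_I; apply: spanned_word; apply: GP.
- by apply: spanI; apply: turn_I.
move=> w wc Q sQ QG Qy.
have [->|w0] := pselect (w = [::]); first by rewrite (wa_nil wa); apply: QG; rewrite inE eqxx.
have Iw : I (X w) by apply: spanned_word.
have py' x : I x -> x * t y = t (poly_act p x).
  by move=> Ix; rewrite -(turn_mul Ix Iy).2 py.
apply: (Ggen Q sQ _ (X w) Iw) => g k gG.
have Ig : I (X g) by apply: spanned_word; apply: GP.
elim/ltn_ind: k => k IH; have [kD|Dk] := ltnP k D.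
  by apply: QG; rewrite inE; apply/orP; right; apply: allpairs_f => //; rewrite mem_iota.
have D0 : (0 < D)%N by rewrite size_poly_gt0.
pose x := iter (k - D)%N t (X g).
have Ix : I x by apply: iter_turn_I.
have Qx : Q x by apply: IH; lia.
have h := py' x Ix; move: h; rewrite /poly_act t_sum // -[size p]/D.
rewrite -(prednK D0) big_ord_recr /= => h.
have lc : p`_D.-1 != 0 by rewrite -lead_coefE lead_coef_eq0.
have -> : iter k t (X g) = iter D t x by rewrite -iterD subnKC.
rewrite -(prednK D0) /= -[t _]scale1r -(mulVf lc) -scalerA; apply: (subZ sQ).
have -> : p`_D.-1 *: t (iter D.-1 t x) = x * t y - \sum_(i < D.-1) t (p`_i *: iter i t x).
  by apply/eqP; rewrite eq_sym subr_eq h addrC tZ.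
apply: (subB sQ); first exact: Qy.
apply: (sub_sum _ sQ) => i; rewrite tZ; apply: (subZ sQ).
by rewrite -iterS /x -iterD; apply: IH; have := ltn_ord i; lia.
Qed.
End FullTurn.

Definition letter_complements (l : seq 'I_n) : A := \prod_(i <- l) (1 - X [:: i]).

Lemma letter_complements_rcons l i : letter_complements (rcons l i) = letter_complements l - letter_complements l * X [:: i].
Proof. by rewrite /letter_complements -cats1 big_cat /= big_seq1 mulrBr mulr1. Qed.

Lemma proper_letter i : i \in c -> proper [:: i].
Proof. by move=> ic; split=> // j; rewrite inE => /eqP ->. Qed.

Lemma letter_complements_I l : word_over l -> I (1 - letter_complements l).
Proof.
elim/last_ind: l => [_|l i IH]; first by rewrite /letter_complements big_nil subrr; apply: (sub0 sI).
move=> /word_over_rcons[/IH Il ic].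
have Ii : I (X [:: i]) by apply: spanned_word; apply: proper_letter.
have -> : 1 - letter_complements (rcons l i) = (1 - letter_complements l) + (X [:: i] - (1 - letter_complements l) * X [:: i]).
  by rewrite letter_complements_rcons mulrBl mul1r !opprB [X [:: i] + _]addrC subrK -addrA [- letter_complements l + _]addrC.
apply: (subD sI) => //; apply: (subB sI) => //; exact: I_mul.
Qed.

Local Notation degree w := (displacement c (slides w)).

(** The displacement grades the words in such a way that a letter raises the degree
    unless it has no effect. *)
Lemma degree_rcons w i : (degree w <= degree (rcons w i))%N /\
  (degree (rcons w i) = degree w -> slides (rcons w i) = slides w).
Proof.
have aw := adm_slides x0 c_size c_uniq w; have awi := adm_slides x0 c_size c_uniq (rcons w i).
have [<-//|neq] := pselect (slides (rcons w i) = slides w).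
have : (degree w < degree (rcons w i))%N.
  by apply: displacement_lt => // k; rewrite slides_rcons slide_le.
by split; lia.
Qed.

Definition proper_ge d w := proper w /\ (d <= degree w)%N.

Lemma proper_ge_mul d x i : i \in c -> spanned X (proper_ge d) x ->
  spanned X (proper_ge d) (x * X [:: i]).
Proof.
move=> ic Px; apply: (spanned_mul wa (P1 := proper_ge d) (P2 := fun w => w = [:: i])) => //.
  move=> u _ [pu du] ->; split; first exact: (proper_cat pu (proper_letter ic)).
  by rewrite cats1; apply: (leq_trans du); have [] := degree_rcons u i.
by apply: spanned_word.
Qed.

(** In lowest degree [d], multiplication by the letter [i] keeps the words whose
    function is fixed by the slide at [i] and kills the others, since any other
    product has degree greater than [d]. *)
Lemma cf_lowest d x i w : i \in c -> spanned X (proper_ge d) x ->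
  proper w -> degree w = d ->
  cf w (x * X [:: i]) = if `[< slide i (slides w) = slides w >] then cf w x else 0.
Proof.
move=> ic Px pw dw.
apply: (Px (fun x => cf w (x * X [:: i]) = if `[< slide i (slides w) = slides w >] then cf w x else 0)).
  split.
  - by rewrite mul0r (cf0 wa); case: ifP.
  - by move=> y z; rewrite mulrDl !(wa_cfD wa) => -> ->; case: ifP; rewrite ?addr0.
  - by move=> a y; rewrite -scalerAl !(wa_cfZ wa) => ->; case: ifP; rewrite ?mulr0.
move=> v [pv dv]; rewrite -(wa_cat wa) cats1 !(wa_cfX wa).
have sl : w ~~> rcons v i -> slides (rcons v i) = slides w.
  by move=> h; apply/esym; apply: (slides_cong (e := e)).
have veq : w ~~> rcons v i -> slides v = slides w.
  move=> /sl h; rewrite -h; apply/esym; apply: (degree_rcons v i).2.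
  by have [] := degree_rcons v i; rewrite h dw; lia.
have vw : w ~~> rcons v i -> w ~~> v.
  by move=> h; apply: faithful; [exact: pw.1 | exact: pv.1 | rewrite veq].
case: (asboolP (slide i (slides w) = slides w)) => fix_w.
- suff -> : `[< w ~~> rcons v i >] = `[< w ~~> v >] by [].
  apply: asbool_equiv_eq; split=> // h.
  apply: (hk_trans h); apply: hk_sym; apply: (absorb (x0 := x0) c_size c_uniq c_arrow pv.1 ic).
  by have <- : slides w = slides v by apply: (slides_cong (e := e)).
- case: asboolP => //= h; case: fix_w.
  by rewrite -{1}(veq h) -slides_rcons sl.
Qed.

(** Each factor [1 - X [:: i]] kills the words of lowest degree that absorb [i], and
    never brings back a word of lowest degree. *)
Lemma letter_complements_kill d x l : word_over l -> spanned X (proper_ge d) x ->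
  spanned X (proper_ge d) (x * letter_complements l) /\
  forall w i, proper w -> degree w = d -> i \in l -> slide i (slides w) = slides w ->
    cf w (x * letter_complements l) = 0.
Proof.
move=> + Px; elim/last_ind: l => [_|l j IH].
  by split=> //; rewrite /letter_complements big_nil mulr1.
move=> /word_over_rcons[/IH[Pg hg] jc]; rewrite letter_complements_rcons mulrBr mulrA; split.
  by apply: (subB (spanned_subspace _ _)) => //; apply: proper_ge_mul.
move=> w i pw dw; rewrite mem_rcons inE (cfB wa) (cf_lowest jc Pg pw dw).
case: asboolP => [_ _ _|fw]; first by rewrite subrr.
case/orP => [/eqP -> //|il fi]; rewrite subr0; exact: (hg w i).
Qed.

(** If [x = x * letter_complements c], no word of lowest degree can occur in [x]: it
    ends in a letter of [c], which it absorbs. *)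
Lemma letter_complements_regular x : I x -> x * (1 - letter_complements c) = 0 -> x = 0.
Proof.
move=> Ix; rewrite mulrBr mulr1 => /eqP; rewrite subr_eq0 => /eqP xE.
apply: (cf_inj wa) => w; apply/eqP; apply: contraT => cw.
have ex : exists d, `[< exists w, [/\ proper w, cf w x != 0 & degree w = d] >].
  have [v pv wv] := spanned_cf wa Ix cw; exists (degree w); apply/asboolP; exists w; split=> //.
  exact: (proper_cong (hk_sym wv)).
case: (ex_minnP ex) => d /asboolP[{cw}{}w [pw cw dw]] dmin.
have Px : spanned X (proper_ge d) x.
  apply: (wa_supp wa (spanned_subspace _ _)) => v cv; apply: spanned_word.
  have [v' pv' vv'] := spanned_cf wa Ix cv.
  have pv : proper v by apply: (proper_cong (hk_sym vv')).
  by split=> //; apply: dmin; apply/asboolP; exists v.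
have [_ kill] := letter_complements_kill (l := c) (fun _ => id) Px.
move: cw; rewrite xE; case/lastP: w pw dw => [[]//|w i] pw dw.
have ic : i \in c by case: pw => /word_over_rcons[].
by rewrite (kill _ i) ?eqxx // slides_rcons slide_idem.
Qed.

Lemma cycle_finite : finite_over_poly X [pred i | i \in c].
Proof.
have [t [tD tZ tX]] := full_turn_ex.
by apply: (cycle_finite_of_regular tD tZ tX (letter_complements_I (l := c) (fun _ => id))); apply: letter_complements_regular.
Qed.

End CycleAlgebra.

(** * Acyclic components and gluing of components *)

Section Acyclic.
Variables (n : nat) (e : rel 'I_n).
Hypothesis e_or : oriented_graph e.
Local Notation "u ~~> v" := (hk_cong e u v) (at level 70).

(** Take a vertex [v] with the fewest vertices from which it can be reached. If [u] is
    a predecessor of [v], whatever reaches [u] reaches [v], so by minimality [v]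
    reaches [u], and the arrow from [u] to [v] closes a cycle. *)
Lemma acyclic_source (V : {set 'I_n}) : is_acyclic e V -> V != set0 ->
  exists2 s, s \in V & {in V, forall j, ~~ e j s}.
Proof.
move=> Vac /set0Pn[v0 v0V]; apply: contrapT => nosrc.
have pred v : v \in V -> exists2 u, u \in V & e u v.
  move=> vV; apply: contrapT => h; apply: nosrc; exists v => // j jV.
  by apply/negP => ejv; apply: h; exists j.
pose r := [rel x y | [&& x \in V, y \in V & e x y]].
case: (arg_minnP (fun v => #|[set u | connect r u v]|) v0V) => v vV vmin.
have [u uV euv] := pred v vV.
have ruv : r u v by apply/and3P.
have sub : [set z | connect r z u] \subset [set z | connect r z v].
  apply/subsetP => z; rewrite !inE => zu; apply: (connect_trans zu); exact: connect1.
have /eqP eqS : [set z | connect r z u] == [set z | connect r z v].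
  by rewrite eqEcard sub vmin.
have : v \in [set z | connect r z u] by rewrite eqS inE connect0.
rewrite inE => /connectP[p0 rp0]; case/shortenP: rp0 => p rp up _ uE.
have ep : path e v p by apply: sub_path rp => x y /and3P[].
have pV : {subset v :: p <= V}.
  move=> x; rewrite inE => /orP[/eqP -> //|].
  have : all (mem V) p.
    elim: (p) (v) rp => //= a p' IH b /andP[/and3P[_ aV _] /IH ->].
    by rewrite aV.
  by move=> /allP; apply.
apply: Vac; exists (v :: p); split=> //; last by rewrite /= rcons_path ep -uE.
case: e_or => irr asym.
case: p {rp up} uE ep {pV} => [|a [|b p]] //= uE ep.
- by rewrite uE irr in euv.
- by have := asym u v; rewrite euv uE; case/andP: ep => ->.
Qed.

(** A second occurrence of a source [s] moves left through each letter [j]: by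
    commutation if [s] and [j] are not linked, and by [s j s = s j] otherwise. *)
Lemma source_absorb s t : {in t, forall j, ~~ e j s} -> s :: rcons t s ~~> s :: t.
Proof.
elim/last_ind: t => [_|t j IH tP]; first exact: hk_idem.
have tP' : {in t, forall k, ~~ e k s} by move=> k kt; apply: tP; rewrite mem_rcons inE kt orbT.
have jP : ~~ e j s by apply: tP; rewrite mem_rcons inE eqxx.
have st : (s :: t) ++ [:: s] ~~> s :: t by rewrite cats1; apply: IH.
have -> : s :: rcons (rcons t j) s = (s :: t) ++ [:: j; s] by rewrite -!cats1 -catA.
have -> : s :: rcons t j = (s :: t) ++ [:: j] by rewrite -cats1.
have [->|js] := eqVneq j s; first exact/cong_catl/hk_idem.
have [esj|esj] := boolP (e s j).
  apply: (hk_trans (cong_catr [:: j; s] (hk_sym st))).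
  apply: (hk_trans (v := (s :: t) ++ [:: s; j])).
    by rewrite -catA; apply/cong_catl/hk_arrow_l.
  by rewrite -[[:: s; j]]/([:: s] ++ [:: j]) catA; apply: cong_catr.
apply: (hk_trans (v := (s :: t) ++ [:: s; j])).
  by apply/cong_catl/hk_comm; rewrite /linked negb_or jP.
by rewrite -[[:: s; j]]/([:: s] ++ [:: j]) catA; apply: cong_catr.
Qed.

Lemma source_filter s t : {in t, forall j, ~~ e j s} ->
  s :: t ~~> s :: [seq j <- t | j != s].
Proof.
elim/last_ind: t => [_|t j IH tP]; first exact: hk_refl.
have tP' : {in t, forall k, ~~ e k s} by move=> k kt; apply: tP; rewrite mem_rcons inE kt orbT.
rewrite filter_rcons; case: eqVneq => [->|_] /=.
  by apply: (hk_trans (source_absorb tP')); apply: IH.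
by rewrite -!cats1 -!cat_cons; apply/cong_catr/IH.
Qed.

Lemma split_first (s : 'I_n) w : s \in w -> exists u v, s \notin u /\ w = u ++ s :: v.
Proof.
elim: w => // i w IH; rewrite inE; have [<- _|si /= /IH[u [v [su ->]]]] := eqVneq s i.
  by exists [::], w.
by exists (i :: u), v; rewrite inE negb_or si.
Qed.

(** By [source_filter], a word needs a source [s] of [V] at most once; the words
    before and after [s] avoid [s], and induction on [V] applies to them. *)
Lemma acyclic_words (V : {set 'I_n}) : is_acyclic e V ->
  exists L : seq (seq 'I_n), {in L, forall u, {subset u <= V}} /\
    forall w, {subset w <= V} -> exists2 u, u \in L & w ~~> u.
Proof.
have [d] := ubnP #|V|; elim: d V => // d IH V Vd Vac.
have [V0|Vn0] := eqVneq V set0.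
  exists [:: [::]]; split=> [u|[|i w] wV]; first by rewrite inE => /eqP ->.
    by exists [::]; rewrite ?inE //; apply: hk_refl.
  by have := wV i; rewrite V0 !inE eqxx => /(_ isT).
have [s sV sP] := acyclic_source Vac Vn0.
have [|[c [c3 cu cV cc]]|L [LV LP]] := IH (V :\ s).
- by have := cardsD1 s V; rewrite sV; lia.
- by apply: Vac; exists c; split=> // i /cV; rewrite inE => /andP[].
have LV' u : u \in L -> {subset u <= V} by move=> /LV uV i /uV; rewrite inE => /andP[].
exists (L ++ [seq u ++ s :: v | u <- L, v <- L]); split.
  move=> u; rewrite mem_cat => /orP[/LV' //|/allpairsP[[a b] /= [aL bL ->]]] i.
  by rewrite mem_cat inE => /or3P[/(LV' a aL)|/eqP ->|/(LV' b bL)].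
move=> w wV; have [sw|sw] := boolP (s \in w); last first.
  have [|u uL wu] := LP w; last by exists u; rewrite // mem_cat uL.
  by move=> i iw; rewrite !inE wV // andbT; apply: contraNneq sw => <-.
have [u [v [su wE]]] := split_first sw; rewrite {}wE in wV sw *.
have uV i : i \in u -> i \in V by move=> iu; apply: wV; rewrite mem_cat iu.
have vV i : i \in v -> i \in V by move=> iv; apply: wV; rewrite mem_cat inE iv !orbT.
have [|u' u'L uu'] := LP u.
  by move=> i iu; rewrite !inE uV // andbT; apply: contraNneq su => <-.
have [|v' v'L vv'] := LP [seq j <- v | j != s].
  by move=> i; rewrite mem_filter !inE => /andP[-> /vV].
exists (u' ++ s :: v').
  rewrite mem_cat; apply/orP; right.
  exact: (allpairs_f (fun u v => u ++ s :: v)).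
apply: hk_cat => //; apply: (hk_trans (source_filter _)).
  by move=> j /vV /sP.
exact: (cong_catl [:: s] vv').
Qed.

End Acyclic.

Section Gluing.
Variables (n : nat) (e : rel 'I_n) (K : fieldType) (A : lalgType K).
Variables (X : seq 'I_n -> A) (cf : seq 'I_n -> A -> K).
Hypothesis wa : word_algebra e X cf.
Local Notation "u ~~> v" := (hk_cong e u v) (at level 70).
Implicit Types W V : {pred 'I_n}.

Definition alphabet W := spanned X (fun w => {subset w <= W}).

Definition right_mul_by W (w : A -> A) : Prop :=
  exists2 p, alphabet W p & w = fun x => x * p.

Definition unlinked W V := {in W & V, forall i j, i != j /\ ~~ linked e i j}.

Lemma acyclic_finite (V : {set 'I_n}) : oriented_graph e -> is_acyclic e V ->
  finite_over_poly X [pred i | i \in V].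
Proof.
move=> e_or /(acyclic_words e_or)[L [LV LP]]; exists (map X L), 1; split.
- by move=> _ /mapP[u /LV uV ->]; apply: spanned_word.
- by rewrite -(wa_nil wa); apply: spanned_word.
move=> w /LP[u uL wu] Q _ QG _; rewrite (wa_cong wa wu); apply: QG; exact: map_f.
Qed.

Lemma finite_over_poly_eq W V : W =i V -> finite_over_poly X W -> finite_over_poly X V.
Proof.
move=> WV [G [y [GW yW gW]]].
have sub (w : seq 'I_n) : {subset w <= W} -> {subset w <= V} by move=> wW i /wW; rewrite WV.
exists G, y; split; [|exact: (spanned_sub sub yW)|].
  by move=> g /GW; apply: spanned_sub.
by move=> w wV; apply: gW => i /wV; rewrite WV.
Qed.

Lemma unlinked_cat u v : {in u & v, forall i j, ~~ linked e i j} -> u ++ v ~~> v ++ u.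
Proof.
elim: u v => [|i u IHu] v uv; first by rewrite cats0; apply: hk_refl.
have uv' : u ++ v ~~> v ++ u.
  by apply: IHu => j k ju kv; apply: uv; rewrite ?inE ?ju ?orbT.
apply: (hk_trans (cong_catl [:: i] uv')); rewrite -[i :: u]cat1s !catA; apply: cong_catr.
have iv : {in v, forall j, ~~ linked e i j} by move=> j jv; apply: uv; rewrite ?inE ?eqxx.
elim: v iv {uv uv' IHu} => [|j v IH] iv; first exact: hk_refl.
apply: (hk_trans (v := [:: j; i] ++ v)).
  apply: (cong_catr v (u := [:: i; j])); apply: hk_comm; apply: iv; exact: mem_head.
apply: (cong_catl [:: j] (u := [:: i] ++ v)); apply: IH => k kv.
by apply: iv; rewrite inE kv orbT.
Qed.

Lemma split_word W V w : unlinked W V -> {subset w <= [predU W & V]} ->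
  w ~~> [seq i <- w | i \in W] ++ [seq i <- w | i \in V].
Proof.
move=> WV; elim: w => [_|i w IH wWV] /=; first exact: hk_refl.
have {}IH : w ~~> [seq i <- w | i \in W] ++ [seq i <- w | i \in V].
  by apply: IH => j jw; apply: wWV; rewrite inE jw orbT.
have nWV j : j \in W -> j \in V -> False.
  by move=> jW jV; have [] := WV j j jW jV; rewrite eqxx.
apply: (hk_trans (cong_catl [:: i] IH)).
have : i \in [predU W & V] by apply: wWV; apply: mem_head.
rewrite inE /= => /orP[iW|iV].
  by rewrite iW ifN; [apply: hk_refl | apply/negP => /(nWV i iW)].
rewrite iV ifN; last by apply/negP => /nWV; apply.
rewrite -[i :: [seq j <- w | j \in V]]cat1s catA -!cat_cons; apply: cong_catr.
apply: (@unlinked_cat [:: i]) => j k; rewrite inE mem_filter => /eqP -> /andP[kW _].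
by have [_] := WV k i kW iV; rewrite /linked orbC.
Qed.

Lemma alphabet_sub W V x : {subset W <= V} -> alphabet W x -> alphabet V x.
Proof. by move=> WV; apply: spanned_sub => w wW i /wW /WV. Qed.

Lemma alphabet_comm W V x y : unlinked W V -> alphabet W x -> alphabet V y -> x * y = y * x.
Proof.
move=> WV Wx Vy; apply: (Wx (fun x => x * y = y * x)).
  apply: equalizer_subspace.
  - by move=> a b; rewrite mulrDl.
  - by move=> a b; rewrite -scalerAl.
  - by move=> a b; rewrite mulrDr.
  - by move=> a b; rewrite -(wa_scaler wa).
move=> u uW; apply: (Vy (fun y => X u * y = y * X u)).
  apply: equalizer_subspace.
  - by move=> a b; rewrite mulrDr.
  - by move=> a b; rewrite -(wa_scaler wa).
  - by move=> a b; rewrite mulrDl.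
  - by move=> a b; rewrite -scalerAl.
move=> v vV; rewrite -!(wa_cat wa); apply: (wa_cong wa); apply: unlinked_cat.
by move=> i j /uW iW /vV jV; have [] := WV i j iW jV.
Qed.

Lemma alphabet_mul W x y : alphabet W x -> alphabet W y -> alphabet W (x * y).
Proof.
apply: (spanned_mul wa) => u v uW vW i.
by rewrite mem_cat => /orP[/uW|/vW].
Qed.

(** Over [W] union [V], every word factors through a word over [W] followed by a word
    over [V]. So the algebra is the sum of the [alphabet W * g * y^k], where [g] and
    [y] commute with [alphabet W]: multiplication by [g] is a homomorphism of
    [alphabet W]-modules, and [noeth_adjoin] applies to multiplication by [y]. *)
Lemma noeth_glue W V : unlinked W V -> finite_over_poly X V ->
  noeth (right_mul_by W) (alphabet W) ->
  noeth (right_mul_by [predU W & V]) (alphabet [predU W & V]).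
Proof.
move=> WV [G [y [GV yV Vgen]]] nW.
have sW : subspace (alphabet W) := spanned_subspace _ _.
have comm p z : alphabet W p -> alphabet V z -> p * z = z * p := alphabet_comm WV.
pose piece (g : A) := fun x => exists2 b, alphabet W b & x = b * g.
pose B := sumset [seq piece g | g <- G].
have OmD : operators (right_mul_by W) by move=> _ [p _ ->] a b; rewrite mulrDl.
have pieceP C : List.In C [seq piece g | g <- G] ->
    [/\ subspace C, stable_under (right_mul_by W) C & noeth (right_mul_by W) C].
  elim: (G) GV => //= g G' IH GV [<-|]; last first.
    by apply: IH => h hG; apply: GV; rewrite inE hG orbT.
  have gV : alphabet V g by apply: GV; apply: mem_head.
  split.
  - split; first by exists 0; rewrite ?mul0r //; apply: (sub0 sW).
    + move=> a b [a' Wa ->] [b' Wb ->]; exists (a' + b'); rewrite ?mulrDl //.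
      exact: (subD sW).
    + by move=> a b [b' Wb ->]; exists (a *: b'); rewrite ?scalerAl //; apply: (subZ sW).
  - move=> _ _ [p Wp ->] [b Wb ->]; exists (b * p); first exact: alphabet_mul.
    by rewrite -!mulrA (comm p g).
  - apply: (noeth_image (h := fun x => x * g)) => //.
    + by move=> a b; rewrite mulrDl.
    + by move=> a b; rewrite -scalerAl.
    + by move=> _ x [p Wp ->]; rewrite -!mulrA (comm p g).
have sB : subspace B by apply: sumset_subspace => C /pieceP[].
have tB : stable_under (right_mul_by W) B by apply: sumset_stable => // C /pieceP[].
have nB : noeth (right_mul_by W) B by apply: noeth_sumset.
have yD : {morph (fun x => x * y) : u v / u + v} by move=> a b; rewrite mulrDl.
have yZ : scalable (fun x => x * y) by move=> a b; rewrite -scalerAl.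
have nF : noeth (right_mul_by [predU W & V]) (adjoin B (fun x => x * y)).
  apply: (noeth_adjoin (Om := right_mul_by W)) => //.
  - by move=> _ x [p Wp ->]; rewrite -!mulrA (comm p y).
  - move=> _ [p Wp ->]; exists p => //; apply: alphabet_sub Wp => i iW.
    by rewrite inE /= iW.
  - by exists y => //; apply: alphabet_sub yV => i iV; rewrite inE /= iV orbT.
have sF : subspace (adjoin B (fun x => x * y)) by apply: adjoin_subspace.
move=> J sJ tJ Jc; have [N NP] := nF J sJ tJ Jc; exists N => k x Nk Wx.
apply: NP => //; apply: Wx => // w wWV; rewrite (wa_cong wa (split_word WV wWV)) (wa_cat wa).
set u := [seq i <- w | i \in W].
apply: (Vgen [seq i <- w | i \in V] _ (fun z => adjoin B (fun x => x * y) (X u * z))).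
- by move=> i; rewrite mem_filter => /andP[].
- exact: (mulr_subspacer wa (X u) sF).
- move=> g gG; apply: adjoin_base; apply: (@sumset_in _ _ _ (piece g)).
  + by move=> C /pieceP[].
  + elim: (G) gG => //= g' G' IH; rewrite inE => /orP[/eqP ->|/IH]; [by left | by right].
  + by exists (X u) => //; apply: spanned_word => i; rewrite mem_filter => /andP[].
- by move=> z Fz; rewrite mulrA; apply: adjoin_y.
Qed.

Lemma noeth_empty : noeth (right_mul_by pred0) (alphabet pred0).
Proof.
move=> J sJ tJ Jc; have [N NP] := noeth_line 1 sJ tJ Jc; exists N => k x Nk Wx.
apply: NP => //; apply: (Wx (fun x => exists a : K, x = a *: 1)).
  split; first by exists 0; rewrite scale0r.
  - by move=> a b [a' ->] [b' ->]; exists (a' + b'); rewrite scalerDl.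
  - by move=> a b [b' ->]; exists (a * b'); rewrite scalerA.
case=> [_|i w /(_ i)]; first by exists 1; rewrite (wa_nil wa) scale1r.
by rewrite mem_head => /(_ isT).
Qed.

Lemma linked_csym : connect_sym (linked e).
Proof. by apply: sym_connect_sym => i j; rewrite /linked orbC. Qed.

Definition union_of_components W := forall i j, i \in W -> connect (linked e) i j -> j \in W.

Lemma right_noetherian_of_components : oriented_graph e ->
  (forall i, is_oriented_cycle e (component e i) \/ is_acyclic e (component e i)) ->
  right_noetherian A.
Proof.
move=> e_or good.
have fin i : finite_over_poly X [pred j | j \in component e i].
  have [[c [c3 cu cV ca]]|] := good i; last exact: acyclic_finite.
  have ca' : {in c &, forall x y, e x y = (y == next c x)}.
    by move=> x y xc yc; apply: ca; rewrite cV.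
  apply: (finite_over_poly_eq (W := [pred j | j \in c])).
    by move=> j; rewrite !inE -cV inE.
  exact: (cycle_finite wa i c3 cu ca').
have step (r : seq 'I_n) : exists W : {pred 'I_n}, [/\ {subset r <= W}, union_of_components W &
    noeth (right_mul_by W) (alphabet W)].
  elim: r => [|i r [W [rW Wc nW]]]; first by exists (@pred0 'I_n : {pred 'I_n}); split=> //; apply: noeth_empty.
  have [iW|iW] := boolP (i \in W).
    by exists W; split=> // j; rewrite inE => /orP[/eqP ->|/rW].
  exists ([predU W & [pred j | j \in component e i]] : {pred 'I_n}); split.
  - move=> j; rewrite inE => /orP[/eqP ->|/rW jW]; rewrite !inE /= ?connect0 ?orbT //.
    by rewrite jW.
  - move=> j k; rewrite !inE /= => /orP[jW|ij] jk; first by rewrite (Wc j).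
    by rewrite (connect_trans ij jk) orbT.
  - apply: noeth_glue => // j k jW; rewrite !inE => ik.
    have kW : k \notin W.
      by apply: contraNN iW => kW; apply: (Wc k) => //; rewrite linked_csym.
    split; first by apply: contraNneq kW => <-.
    by apply: contraNN kW => jk; apply: (Wc j) => //; apply: connect1.
have [W [rW _ nW]] := step (enum 'I_n).
have Wall x : alphabet W x.
  by apply: spanned_sub (spanned_full wa x) => w _ i _; apply: rW; rewrite mem_enum.
move=> J rJ Jc.
have sJ k : subspace (J k).
  have [J0 JD JM] := rJ k; split=> // a x Jx.
  by rewrite -[x]mulr1 (wa_scaler wa); apply: JM.
have [|N NP] := nW J sJ _ Jc.
  by move=> k _ x [p _ ->]; have [_ _ JM] := rJ k; apply: JM.
exists N => k Nk x; split; first exact: NP.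
exact: (chain_le Jc Nk).
Qed.
End Gluing.

(** * The monoid algebra is an algebra spanned by words *)

Section MonoidAlgebra.
Variables (n : nat) (e : rel 'I_n) (K : fieldType).
Local Notation A := {malg K[HK e]}.
Local Notation "u ~~> v" := (hk_cong e u v) (at level 70).

Definition hk_class (w : seq 'I_n) : HK e := \pi_(HK e) w.

Definition word_mon (w : seq 'I_n) : A := << hk_class w >>.

Definition word_coeff (w : seq 'I_n) (x : A) : K := x@_(hk_class w).

Lemma hk_classP u v : hk_class u = hk_class v <-> u ~~> v.
Proof. exact: hk_piP. Qed.

Lemma hk_class_repr (h : HK e) : hk_class (repr h) = h.
Proof. exact: reprK. Qed.

Lemma hk_class_cat u v : hk_class (u ++ v) = mmul (hk_class u) (hk_class v).
Proof. by rewrite /mmul /= HK_mulE. Qed.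

Lemma word_mon_cat u v : word_mon (u ++ v) = word_mon u * word_mon v.
Proof. by rewrite /word_mon malgM_def fgmulUU mulr1 hk_class_cat. Qed.

Lemma malgZU a b (h : HK e) : a *: << b *g h >> = << a * b *g h >> :> A.
Proof. by apply/malgP => h'; rewrite mcoeffZ !mcoeffU mulrnAr. Qed.

Lemma malgZD a (x y : A) : a *: (x + y) = a *: x + a *: y.
Proof. exact: scalerDr. Qed.

Lemma malgU_word a (h : HK e) : << a *g h >> = a *: word_mon (repr h) :> A.
Proof. by rewrite /word_mon malgZU mulr1 hk_class_repr. Qed.

Lemma malg_add_ind (Q : A -> Prop) : Q 0 -> (forall x y, Q x -> Q y -> Q (x + y)) ->
  (forall a h, Q << a *g h >>) -> forall x, Q x.
Proof. by move=> Q0 QD QU x; rewrite [x]monalgE; elim/big_ind: _. Qed.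

Lemma malg_supp_ind (Q : A -> Prop) : Q 0 -> (forall x y, Q x -> Q y -> Q (x + y)) ->
  forall x, (forall h, x@_h != 0 -> Q << x@_h *g h >>) -> Q x.
Proof.
move=> Q0 QD x QU; rewrite [x]monalgE big_seq; elim/big_ind: _ => // h.
by rewrite -mcoeff_neq0; apply: QU.
Qed.

Lemma malg_scaler a (x y : A) : a *: (x * y) = x * (a *: y).
Proof.
elim/malg_add_ind: x => [|x x' Hx Hx'|b h]; first by rewrite !mul0r scaler0.
  by rewrite !mulrDl (malgZD a) Hx Hx'.
elim/malg_add_ind: y => [|y y' Hy Hy'|d h']; first by rewrite scaler0 !mulr0 scaler0.
  by rewrite (malgZD a) !mulrDr (malgZD a) Hy Hy'.
by rewrite malgZU !malgM_def !fgmulUU malgZU mulrCA.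
Qed.

Section LinearExtension.
Variables (W : lmodType K) (g : HK e -> W).

Definition lin_ext (x : A) : W := \sum_(h <- msupp x) x@_h *: g h.

Lemma lin_extE (d : {fset HK e}) (x : A) : (msupp x `<=` d)%fset ->
  lin_ext x = \sum_(h <- d) x@_h *: g h.
Proof.
move=> xd; rewrite /lin_ext (big_fset_incl _ xd) // => h _ hx.
by rewrite mcoeff_outdom // scale0r.
Qed.

Lemma lin_extD : {morph lin_ext : x y / x + y}.
Proof.
move=> x y; pose d := (msupp x `|` msupp y)%fset.
rewrite (lin_extE (msuppD_le x y)) (@lin_extE d x) ?fsubsetUl //.
rewrite (@lin_extE d y) ?fsubsetUr // -big_split; apply: eq_bigr => h _.
by rewrite mcoeffD scalerDl.
Qed.

Lemma lin_extZ : scalable lin_ext.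
Proof.
move=> a x; rewrite (lin_extE (msuppZ_le a x)) scaler_sumr; apply: eq_bigr => h _.
by rewrite mcoeffZ scalerA.
Qed.

Lemma lin_extU h : lin_ext << h >> = g h.
Proof. by rewrite (@lin_extE [fset h]%fset) ?msuppU_le // big_seq_fset1 mcoeffUU scale1r. Qed.
End LinearExtension.

Lemma malg_word_algebra :
  @word_algebra n e K {malg K[HK e]} word_mon word_coeff.
Proof.
split.
- by [].
- exact: word_mon_cat.
- by move=> u v /hk_classP uv; rewrite /word_mon uv.
- exact: malg_scaler.
- by move=> w x y; rewrite /word_coeff mcoeffD.
- by move=> w a x; rewrite /word_coeff mcoeffZ.
- move=> w u; rewrite /word_coeff mcoeffU1; case: asboolP => [/hk_classP ->|wu].
    by rewrite eqxx.
  by case: eqP => // /hk_classP /hk_sym.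
- move=> x Q sQ Qx; apply: malg_supp_ind; [exact: (sub0 sQ)|exact: (subD sQ)|].
  move=> h xh; rewrite malgU_word; apply: (subZ sQ); apply: Qx.
  by rewrite /word_coeff hk_class_repr.
- move=> W f fP; exists (lin_ext (fun h => f (repr h))); split.
  + exact: lin_extD.
  + exact: lin_extZ.
  + by move=> w; rewrite lin_extU; apply: fP; apply/hk_classP; rewrite hk_class_repr.
Qed.
End MonoidAlgebra.

(** * Chains of right congruences *)

Section Congruences.
Variables (n : nat) (e : rel 'I_n) (K : fieldType) (A : lalgType K).
Variables (X : seq 'I_n -> A) (cf : seq 'I_n -> A -> K).
Hypothesis wa : word_algebra e X cf.
Local Notation "u ~~> v" := (hk_cong e u v) (at level 70).

Variable R : nat -> seq 'I_n -> seq 'I_n -> Prop.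
Hypotheses (R_cong : forall k u v, u ~~> v -> R k u v)
  (R_sym : forall k u v, R k u v -> R k v u)
  (R_trans : forall k u v w, R k u v -> R k v w -> R k u w)
  (R_cat : forall k u v w, R k u v -> R k (u ++ w) (v ++ w))
  (R_mono : forall k u v, R k u v -> R k.+1 u v).

(** The right ideal spanned by the differences [X u - X v] with [R k u v], given as
    the common kernel of the functionals that vanish on them. *)
Definition vanishing k (x : A) : Prop := forall G : A -> K^o,
  {morph G : y z / y + z} -> scalable G ->
  (forall u v, R k u v -> G (X u) = G (X v)) -> G x = 0.

Lemma vanishing_ideal k : is_right_ideal (vanishing k).
Proof.
split.
- by move=> G GD GZ _; rewrite -(scale0r 0) GZ scale0r.
- by move=> x y Vx Vy G GD GZ Gk; rewrite GD Vx // Vy // addr0.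
move=> x a Vx.
have sV : subspace (vanishing k).
  split.
  - by move=> G GD GZ _; rewrite -(scale0r 0) GZ scale0r.
  - by move=> y z Vy Vz G GD GZ Gk; rewrite GD Vy // Vz // addr0.
  - by move=> b y Vy G GD GZ Gk; rewrite GZ Vy // scaler0.
move: a; suff h (a : A) : vanishing k ((x : A) * a) by apply: h.
apply: (words_span wa (Q := fun a => vanishing k (x * a))).
  exact: (mulr_subspacer wa x sV).
move=> w G GD GZ Gk.
apply: (Vx (fun z => G (z * X w))).
- by move=> y z; rewrite mulrDl GD.
- by move=> b y; rewrite -scalerAl GZ.
- by move=> u v uv; rewrite -!(wa_cat wa); apply/Gk/R_cat.
Qed.

(** Words [u], [v] identified by [R k.+1] but not by [R k] give an element [X u - X v]
    of the ideal of index [k.+1] that is not in the ideal of index [k]: the indicator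
    of the [R k]-class of [u] separates them. *)
Lemma not_right_noetherian :
  (forall k, exists u v, R k.+1 u v /\ ~ R k u v) -> ~ right_noetherian A.
Proof.
move=> strict /(_ _ vanishing_ideal) [k x Vx G GD GZ Gk|N NP].
  by apply: Vx => // u v uv; apply/Gk/R_mono.
have [u [v [uv nuv]]] := strict N.
have [w w' ww'|G [GD GZ GX]] :=
    wa_ext wa (W := K^o) (f := fun w => (`[< R N u w >])%:R : K^o).
  suff -> : `[< R N u w >] = `[< R N u w' >] by [].
  apply: asbool_equiv_eq; split=> h; apply: (R_trans h); first exact: R_cong.
  by apply/R_sym/R_cong.
have /(NP N.+1 (leqnSn N)) V : vanishing N.+1 (X u - X v).
  by move=> H HD HZ Hk; rewrite -scaleN1r HD HZ (Hk u v uv) scaleN1r subrr.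
have := V G GD GZ; rewrite -scaleN1r GD GZ !GX.
have -> : `[< R N u u >] = true by apply/asboolP/R_cong/hk_refl.
have -> : `[< R N u v >] = false by apply/asboolP.
rewrite scaler0 addr0 => /(_ _)/eqP; rewrite oner_eq0 => h; suff: false by [].
apply: h => a b ab; rewrite !GX.
suff -> : `[< R N u a >] = `[< R N u b >] by [].
by apply: asbool_equiv_eq; split=> h; apply: (R_trans h) => //; apply: R_sym.
Qed.
End Congruences.

(** * A cycle with a neighbour *)

Section Dynamics.
Variables (n : nat) (e : rel 'I_n).
Hypothesis e_or : oriented_graph e.
Variable phi : 'I_n -> ('I_n -> nat) -> nat.

Definition put (i : 'I_n) (t : nat) (a : 'I_n -> nat) : 'I_n -> nat :=
  fun j => if j == i then t else a j.

(** The new label at [i] depends only on labels at the origins of arrows into [i]; in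
    particular it does not depend on the old label at [i]. *)
Hypothesis phi_local : forall i j t a, ~~ e j i -> phi i (put j t a) = phi i a.

Definition update (a : 'I_n -> nat) (i : 'I_n) := put i (phi i a) a.

Lemma update_comm a i j : i != j -> ~~ linked e i j ->
  update (update a i) j = update (update a j) i.
Proof.
move=> ij; rewrite /linked negb_or => /andP[nij nji]; rewrite /update !phi_local //.
by apply/funext => k; rewrite /put; case: (eqVneq k j) => [->|//]; rewrite eq_sym (negPf ij).
Qed.

Lemma update_idem a i : update (update a i) i = update a i.
Proof.
rewrite /update phi_local ?e_or.1 //.
by apply/funext => k; rewrite /put; case: eqP.
Qed.

Lemma arrow_back i j : e i j -> i != j /\ ~~ e j i.
Proof.
case: e_or => irr asym eij; split; last by have := asym i j; rewrite eij.
by apply: contraTneq eij => ->; rewrite irr.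
Qed.

Lemma update_arrow_l a i j : e i j ->
  update (update (update a i) j) i = update (update a i) j.
Proof.
move=> /arrow_back[ij nji]; have nii : ~~ e i i by rewrite e_or.1.
rewrite /update (phi_local _ _ nji) (phi_local _ _ nii).
apply/funext => k; rewrite /put; case: (eqVneq k i) => [->|//].
by rewrite (negPf ij).
Qed.

Lemma update_arrow_r a i j : e i j ->
  update (update (update a j) i) j = update (update a i) j.
Proof.
move=> /arrow_back[ij nji]; rewrite /update (phi_local _ _ nji).
have -> : put i (phi i a) (put j (phi j a) a) = put j (phi j a) (put i (phi i a) a).
  apply/funext => k; rewrite /put; case: (eqVneq k i) => [->|//].
  by rewrite (negPf ij).
have njj : ~~ e j j by rewrite e_or.1.
rewrite (phi_local _ _ njj).
by apply/funext => k; rewrite /put; case: eqP.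
Qed.

(** All the defining relations reflect locality: updates at vertices that are not
    linked are independent, and if [i -> j] then an update at [j] does not influence
    a later update at [i]. *)
Lemma run_cong u v a : hk_cong e u v -> foldl update a u = foldl update a v.
Proof.
move=> uv; elim: uv a => {u v} //.
- by move=> u v w _ uv _ vw a; rewrite uv vw.
- by move=> u u' v v' _ uu' _ vv' a; rewrite !foldl_cat uu' vv'.
- by move=> i a; apply: update_idem.
- move=> i j nij a /=; have [->//|ij] := eqVneq i j; exact: update_comm.
- by move=> i j eij a; apply: update_arrow_l.
- by move=> i j eij a; apply: update_arrow_r.
Qed.
End Dynamics.

Section CycleWithNeighbour.
Variables (n : nat) (e : rel 'I_n) (K : fieldType) (A : lalgType K).
Variables (X : seq 'I_n -> A) (cf : seq 'I_n -> A -> K).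
Hypotheses (wa : word_algebra e X cf) (e_or : oriented_graph e).
Variables (x v : 'I_n) (p : seq 'I_n).
Local Notation c := (x :: p).
Hypotheses (c_uniq : uniq c) (c_cycle : cycle e c) (vc : v \notin c) (xv : linked e x v).

(** Labels travel along the cycle and grow at [x]. If [x -> v], the vertex [v] records
    the label of [x]. Otherwise [v -> x], an update at [v] sets its label to 1 for
    ever, and from then on labels do not grow at [x] any more. *)
Definition counter (i : 'I_n) (a : 'I_n -> nat) : nat :=
  if i == v then (if e x v then a x else 1)%N
  else if i == x then (a (prev c x) + (e x v || (a v == 0)))%N
  else if i \in p then a (prev c i) else 0%N.

Let xv_neq : x != v.
Proof. by apply: contraNneq vc => <-; apply: mem_head. Qed.

Lemma counter_local i j t a : ~~ e j i -> counter i (put j t a) = counter i a.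
Proof.
move=> eji; rewrite /counter /put.
have prevP k : k \in c -> k = i -> prev c k != j.
  by move=> kc ki; apply: contraNneq eji => <-; rewrite -ki; apply: prev_cycle.
case: (eqVneq i v) => [iv|iv].
  by case: ifP => // exv; case: (eqVneq x j) => // xj; rewrite -xj iv exv in eji.
case: (eqVneq i x) => [ix|ix].
  rewrite (negPf (prevP x _ _)) ?mem_head //.
  have [exv|exv] := boolP (e x v) => //=; case: (eqVneq v j) => // vj.
  by move: xv eji; rewrite /linked (negPf exv) -vj ix => /= ->.
case: ifP => // ip; rewrite (negPf (prevP i _ _)) //.
by rewrite inE ip orbT.
Qed.

Local Notation upd := (update counter).
Local Notation run := (foldl upd (fun _ => 0%N)).

Lemma copy_along q y a : path (fun y z => y == prev c z) y q ->
  {subset q <= p} -> x \notin q ->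
  forall z, foldl upd a q z = if z \in q then a y else a z.
Proof.
elim: q y a => // b q IH y a /= /andP[/eqP yb bq] qp xq z.
have bp : b \in p by apply: qp; apply: mem_head.
have bv : b != v by apply: contraNneq vc => <-; rewrite inE bp orbT.
have bx : b != x by apply: contraNneq xq => <-; apply: mem_head.
have cb : counter b a = a y by rewrite /counter (negPf bv) (negPf bx) bp yb.
rewrite (IH b) //; last 2 first.
- by move=> k kq; apply: qp; rewrite inE kq orbT.
- by apply: contraNN xq => xq; rewrite inE xq orbT.
rewrite /update cb /put eqxx inE; case: (eqVneq z b) => [->|//].
by case: ifP.
Qed.

Lemma turn_adds1 a t : a v = 0%N -> (forall z, z \in c -> a z = t) ->
  forall z, foldl upd a c z = if z \in c then t.+1 else a z.
Proof.
move=> av at_ z.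
have cx : counter x a = t.+1.
  by rewrite /counter (negPf xv_neq) eqxx av eqxx orbT addn1 at_ // mem_prev mem_head.
rewrite [foldl _ _ _]/= (copy_along (y := x)) //; first last.
- by move: c_uniq => /= /andP[].
- by have := cycle_prev c_uniq; rewrite /= rcons_path => /andP[].
by rewrite /update cx /put eqxx inE; case: (eqVneq z x) => [->|//]; case: ifP.
Qed.

Definition turns k : seq 'I_n := iter k (fun w => w ++ c) [::].

Lemma run_turns k z : run (turns k) z = if z \in c then k else 0%N.
Proof.
elim: k z => [|k IH] z; first by case: (z \in c).
rewrite [turns _]/= foldl_cat (@turn_adds1 _ k).
- by rewrite IH; case: (z \in c).
- by rewrite IH (negPf vc).
- by move=> y yc; rewrite IH yc.
Qed.

Lemma run_sample k z : run (turns k ++ [:: v]) z =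
  if z == v then if e x v then k else 1%N else if z \in c then k else 0%N.
Proof.
have -> : run (turns k ++ [:: v]) = upd (run (turns k)) v by rewrite foldl_cat.
rewrite {1}/update /put run_turns; case: (eqVneq z v) => // _.
by rewrite /counter eqxx run_turns mem_head.
Qed.

Definition frozen k (a : 'I_n -> nat) : Prop :=
  a v = 1%N /\ forall j, j \in c -> (a j <= k)%N.

(** If [x -> v], old records at [v] influence nothing but the label of [v] itself. If
    [v -> x], the label 1 at [v] stops the growth, so the frozen states form a
    subset that is stable under all updates and can be collapsed to a point. *)
Definition indist k (a b : 'I_n -> nat) : Prop :=
  if e x v then (forall j, j != v -> a j = b j) /\ (a v = b v \/ (a v <= k)%N /\ (b v <= k)%N)
  else a = b \/ frozen k a /\ frozen k b.

Lemma frozen_upd k a i : ~~ e x v -> frozen k a -> frozen k (upd a i).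
Proof.
move=> exv [av ak]; rewrite /update /put /counter; split.
  by case: (eqVneq v i) => [_|//]; rewrite (negPf exv).
move=> j jc; have jv : j != v by apply: contraNneq vc => <-.
case: (eqVneq j i) => [<-|_]; last exact: ak.
rewrite (negPf jv) (negPf exv) av [nat_of_bool _]/= addn0; case: eqP => [_|_].
  by apply: ak; rewrite mem_prev mem_head.
by case: ifP => // _; apply: ak; rewrite mem_prev.
Qed.

Lemma indist_upd k a b i : indist k a b -> indist k (upd a i) (upd b i).
Proof.
rewrite /indist; case: ifPn => exv; last first.
  by case=> [->|[fa fb]]; [left | right; split; apply: frozen_upd].
case=> ab abv; have abc j : j \in c -> a j = b j.
  by move=> jc; apply: ab; apply: contraNneq vc => <-.
have cab : counter i a = counter i b.
  rewrite /counter exv abc ?mem_head //; case: ifP => // _.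
  case: eqP => [_|_]; first by rewrite abc // mem_prev mem_head.
  by case: ifP => // ip; rewrite abc // mem_prev inE ip orbT.
rewrite /update cab /put; split=> [j jv|]; first by case: ifP => // _; apply: ab.
by case: ifP => // _; left.
Qed.

(** After [k.+1] turns the cycle carries the label [k.+1]. Updating [v] at that moment
    produces a state that becomes identified with that of the second word at step
    [k.+1] and not earlier. *)
Lemma neighbour_not_noetherian : ~ right_noetherian A.
Proof.
pose R k u w := indist k (run u) (run w).
apply: (not_right_noetherian wa (R := R)).
- move=> k u w /(run_cong e_or counter_local (fun _ => 0%N)) uw; rewrite /R uw /indist.
  by case: ifP => _; [split=> //; left | left].
- rewrite /R /indist => k u w; case: ifP => _ [].
  + by move=> h [->|[h1 h2]]; split; [move=> j /h|left|move=> j /h|right].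
  + by move=> ->; left.
  + by move=> [h1 h2]; right.
- rewrite /R /indist => k u w z; case: ifP => _.
  + move=> [h1 h2] [h3 h4]; split; first by move=> j jv; rewrite h1 // h3.
    by case: h2 => [->|[? ?]]; case: h4 => [<-|[? ?]]; [left|right|right|right].
  + by case=> [->|[h1 h2]] // [<-|[h3 h4]]; right.
- move=> k u w z; rewrite /R !foldl_cat; elim: z (run u) (run w) => //= i z IH a b ab.
  by apply/IH/indist_upd.
- move=> k u w; rewrite /R /indist; case: ifP => _.
  + by move=> [h1 [h2|[h2 h3]]]; split=> //; [left | right; split; apply: leqW].
  + case=> [->|[[a1 a2] [b1 b2]]]; [by left | right].
    by split; split=> // j jc; apply: leqW; [apply: a2 | apply: b2].
move=> k; exists (turns k.+1 ++ [:: v]).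
exists (if e x v then turns k.+1 else turns 0 ++ [:: v]).
have vc' j : j \in c -> (j == v) = false by move=> jc; apply: contraNF vc => /eqP <-.
rewrite /R /indist; have [exv|exv] := boolP (e x v).
  rewrite run_sample run_turns eqxx exv (negPf vc); split.
    by split=> [j /negPf jv|]; [rewrite run_sample jv run_turns | right].
  by case=> _ [//|[]]; rewrite ltnn.
split.
  by right; split; split; rewrite ?run_sample ?eqxx ?(negPf exv) // => j jc;
    rewrite run_sample vc' // jc.
case=> [/(congr1 (fun f => f x))|[[_ /(_ x (mem_head _ _))]]].
  by rewrite !run_sample (negPf xv_neq) mem_head.
by rewrite run_sample (negPf xv_neq) mem_head ltnn.
Qed.
End CycleWithNeighbour.

(** * Shortest cycles *)

Section ShortestCycle.
Variables (n : nat) (e : rel 'I_n).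
Hypothesis e_or : oriented_graph e.

Lemma cycle_size3 (c : seq 'I_n) : c != [::] -> cycle e c -> (3 <= size c)%N.
Proof.
case: e_or => irr asym; case: c => [|x [|y [|z c]]] //= _.
  by rewrite irr.
by rewrite andbT => h; have := asym x y; rewrite h.
Qed.

(** A chord from [x] to [y] closes the part of [c] that leads from [y] to [x]. *)
Lemma chord_shortens c x y : uniq c -> cycle e c -> x \in c -> y \in c ->
  e x y -> y != next c x -> exists c', 
  [/\ (size c' < size c)%N, uniq c', {subset c' <= c}, cycle e c' & c' != [::]].
Proof.
move=> cu cc xc yc exy yn; have [i p rot_c] := rot_to yc.
have cu' : uniq (y :: p) by rewrite -rot_c rot_uniq.
have cc' : cycle e (y :: p) by rewrite -rot_c rot_cycle.
have nx : next c x = next (y :: p) x by rewrite -rot_c next_rot.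
have xyp : x \in y :: p by rewrite -rot_c mem_rot.
have szc : size c = (size p).+1 by rewrite -(size_rot i) rot_c.
have cE z : (z \in c) = (z \in y :: p) by rewrite -(mem_rot i) rot_c.
move: xyp; rewrite inE => /predU1P[xy|xp].
  by rewrite xy e_or.1 in exy.
case/splitPr: xp nx cu' cc' szc cE => p1 p2 nx cu' cc' szc cE.
have p20 : p2 != [::].
  apply: contraNneq yn => p20; rewrite p20 in nx cu'.
  have := cycle_next cu'; move: (next (y :: p1 ++ [:: x])) nx => f nx.
  by rewrite /= rcons_path last_cat /= nx => /andP[_ /eqP ->].
exists (y :: rcons p1 x); split=> //.
- by rewrite szc size_cat /= size_rcons; case: (p2) p20 => //= *; lia.
- by move: cu'; rewrite -cat_rcons -cat_cons cat_uniq => /and3P[].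
- by move=> z; rewrite cE -cat_rcons -cat_cons mem_cat => ->.
- move: cc'; rewrite -cat_rcons /= rcons_cat cat_path => /andP[ep _].
  by rewrite rcons_path ep last_rcons exy.
Qed.

Lemma boundary_edge (c : seq 'I_n) x z : x \in c -> z \notin c ->
  connect (linked e) x z -> exists y v, [/\ y \in c, v \notin c & linked e y v].
Proof.
move=> xc zc /connectP[p + zE]; rewrite {}zE in zc *.
elim: p x xc zc => [|a p IH] x xc /=; first by rewrite xc.
move=> zc /andP[xa ap]; have [ac|ac] := boolP (a \in c); first exact: (IH a).
by exists x, a.
Qed.

Section Component.
Variables (K : fieldType) (A : lalgType K) (X : seq 'I_n -> A) (cf : seq 'I_n -> A -> K).
Hypothesis wa : word_algebra e X cf.

(** A shortest cycle of the component has no chord, by [chord_shortens], and contains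
    the whole component: otherwise some edge leaves it, contradicting
    [neighbour_not_noetherian]. *)
Lemma noetherian_component i : right_noetherian A ->
  is_oriented_cycle e (component e i) \/ is_acyclic e (component e i).
Proof.
move=> nA; have [|notac] := pselect (is_acyclic e (component e i)); [by right | left].
pose good c := [/\ c != [::], uniq c, {subset c <= component e i} & cycle e c].
have ex : exists s, `[< exists2 c, good c & size c = s >].
  apply: contrapT => h; apply: notac => -[c [c3 cu ci cc]]; apply: h.
  exists (size c); apply/asboolP; exists c => //; split=> //.
  by case: (c) c3.
case: (ex_minnP ex) => s /asboolP[c [c0 cu ci cc] cs] smin.
have no_boundary y v : y \in c -> v \notin c -> ~ linked e y v.
  move=> yc vc yv; have [k p rot_c] := rot_to yc.
  apply: (@neighbour_not_noetherian _ _ _ _ _ _ wa e_or y v p _ _ _ yv nA).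
  - by rewrite -rot_c rot_uniq.
  - by rewrite -rot_c rot_cycle.
  - by rewrite -rot_c mem_rot.
have [x xc] : exists x, x \in c by case: (c) c0 => // x c' _; exists x; apply: mem_head.
have Vc : component e i =i c.
  move=> z; apply/idP/idP => [|/ci //]; rewrite inE => iz; apply: contraT => zc.
  have ix : connect (linked e) i x by have := ci x xc; rewrite inE.
  have xz : connect (linked e) x z by rewrite (connect_trans _ iz) // linked_csym.
  by have [y [v [yc vc yv]]] := boundary_edge xc zc xz; case: (no_boundary y v).
exists c; split=> //; first exact: cycle_size3.
move=> a b; rewrite !Vc => ac bc; apply/idP/eqP => [eab|->]; last exact: next_cycle.
apply/eqP; apply: contraT => bn.
have [c' [c'c c'u c'sub c'c2 c'0]] := chord_shortens cu cc ac bc eab bn.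
have := smin (size c'); rewrite leqNgt -cs c'c; apply; apply/asboolP; exists c' => //.
by split=> // z /c'sub /ci.
Qed.
End Component.
End ShortestCycle.

(** * Exchanging left and right *)

Section Reversal.
Variables (n : nat) (e : rel 'I_n).

Definition reverse_graph : rel 'I_n := fun i j => e j i.
Local Notation e' := reverse_graph.

Lemma reverse_oriented : oriented_graph e -> oriented_graph e'.
Proof. by case=> irr asym; split=> [i|i j]; [apply: irr | rewrite andbC; apply: asym]. Qed.

Lemma reverse_linked : linked e' = linked e.
Proof. by apply/funext => i; apply/funext => j; rewrite /linked orbC. Qed.

Lemma reverse_cong u v : hk_cong e u v -> hk_cong e' (rev u) (rev v).
Proof.
elim=> {u v}; rewrite /rev /=.
- by move=> u; apply: hk_refl.
- by move=> u v _; apply: hk_sym.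
- by move=> u v w _ uv _; apply: hk_trans.
- by move=> u u' v v' _ uu' _ vv'; rewrite -!/(rev _) !rev_cat; apply: hk_cat.
- by move=> i; apply: hk_idem.
- by move=> i j ij; apply: hk_comm; rewrite reverse_linked /linked orbC.
- by move=> i j eij; apply: hk_arrow_r.
- by move=> i j eij; apply: hk_arrow_l.
Qed.

Lemma reverse_acyclic (V : {set 'I_n}) : is_acyclic e V -> is_acyclic e' V.
Proof.
move=> ac [c [c3 cu cV cc]]; apply: ac; exists (rev c).
rewrite size_rev rev_uniq; split=> //; first by move=> x; rewrite mem_rev; apply: cV.
by rewrite rev_cycle.
Qed.

Lemma reverse_is_cycle (V : {set 'I_n}) : is_oriented_cycle e V -> is_oriented_cycle e' V.
Proof.
move=> [c [c3 cu Vc ca]]; exists (rev c); rewrite size_rev rev_uniq; split=> //.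
  by move=> x; rewrite mem_rev.
move=> x y xV yV; rewrite /e' ca // next_rev //.
by apply/eqP/eqP => ->; rewrite ?(prev_next cu) ?(next_prev cu).
Qed.

Lemma reverse_component i : component e' i = component e i.
Proof. by rewrite /component reverse_linked. Qed.
End Reversal.

Section OppositeAlgebra.
Variables (K : fieldType) (A A' : lalgType K) (F : A -> A') (F' : A' -> A).
Hypotheses (FD : {morph F : x y / x + y}) (F0 : F 0 = 0)
  (FM : forall x y, F (x * y) = F y * F x)
  (F'D : {morph F' : x y / x + y}) (F'0 : F' 0 = 0)
  (F'M : forall x y, F' (x * y) = F' y * F' x)
  (FK : cancel F F') (F'K : cancel F' F).

Lemma right_to_left : right_noetherian A' -> left_noetherian A.
Proof.
move=> nA J lJ Jc; have [||N NP] := nA (fun k x => J k (F' x)).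
- move=> k; have [J0 JD JM] := lJ k; split; first by rewrite F'0.
  + by move=> x y Jx Jy; rewrite F'D; apply: JD.
  + by move=> x a Jx; rewrite F'M; apply: JM.
- by move=> k x; apply: Jc.
by exists N => k Nk x; have := NP k Nk (F x); rewrite FK.
Qed.

Lemma left_to_right : left_noetherian A -> right_noetherian A'.
Proof.
move=> nA J rJ Jc; have [||N NP] := nA (fun k x => J k (F x)).
- move=> k; have [J0 JD JM] := rJ k; split; first by rewrite F0.
  + by move=> x y Jx Jy; rewrite FD; apply: JD.
  + by move=> x a Jx; rewrite FM; apply: JM.
- by move=> k x; apply: Jc.
by exists N => k Nk x; have := NP k Nk (F' x); rewrite F'K.
Qed.
End OppositeAlgebra.

Section WordReversal.
Variables (n : nat) (e : rel 'I_n) (K : fieldType) (A A' : lalgType K).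
Local Notation e' := (reverse_graph e).
Variables (X : seq 'I_n -> A) (cf : seq 'I_n -> A -> K).
Variables (X' : seq 'I_n -> A') (cf' : seq 'I_n -> A' -> K).
Hypotheses (wa : word_algebra e X cf) (wa' : word_algebra e' X' cf').

Lemma reversal_anti (F : A -> A') : {morph F : x y / x + y} -> scalable F ->
  (forall w, F (X w) = X' (rev w)) -> forall x y, F (x * y) = F y * F x.
Proof.
move=> FD FZ FX x y; apply: (words_span wa (Q := fun x => F (x * y) = F y * F x)).
  apply: equalizer_subspace.
  - by move=> a b; rewrite mulrDl FD.
  - by move=> a b; rewrite -scalerAl FZ.
  - by move=> a b; rewrite FD mulrDr.
  - by move=> a b; rewrite FZ -(wa_scaler wa').
move=> u; apply: (words_span wa (Q := fun y => F (X u * y) = F y * F (X u))).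
  apply: equalizer_subspace.
  - by move=> a b; rewrite mulrDr FD.
  - by move=> a b; rewrite -(wa_scaler wa) FZ.
  - by move=> a b; rewrite FD mulrDl.
  - by move=> a b; rewrite FZ -scalerAl.
by move=> v; rewrite -(wa_cat wa) !FX rev_cat (wa_cat wa').
Qed.

Lemma reversal_K (F : A -> A') (F' : A' -> A) : {morph F : x y / x + y} -> scalable F ->
  (forall w, F (X w) = X' (rev w)) -> {morph F' : x y / x + y} -> scalable F' ->
  (forall w, F' (X' w) = X (rev w)) -> cancel F F'.
Proof.
move=> FD FZ FX F'D F'Z F'X x; apply: (words_span wa (Q := fun x => F' (F x) = x)).
  by apply: equalizer_subspace => // a b; rewrite ?FD ?F'D // FZ F'Z.
by move=> w; rewrite FX F'X revK.
Qed.
End WordReversal.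

(** Reversal of words extends linearly to an anti-isomorphism between the algebras of
    [e] and of [reverse_graph e]. *)
Lemma left_right_reverse (n : nat) (e : rel 'I_n) (K : fieldType) (A A' : lalgType K)
  (X : seq 'I_n -> A) (cf : seq 'I_n -> A -> K)
  (X' : seq 'I_n -> A') (cf' : seq 'I_n -> A' -> K) :
  word_algebra e X cf -> word_algebra (reverse_graph e) X' cf' ->
  left_noetherian A <-> right_noetherian A'.
Proof.
move=> wa wa'.
have [u v uv|F [FD FZ FX]] := wa_ext wa (f := fun w => X' (rev w)).
  exact/(wa_cong wa')/reverse_cong.
have [u v uv|F' [F'D F'Z F'X]] := wa_ext wa' (f := fun w => X (rev w)).
  exact/(wa_cong wa)/(reverse_cong uv).
have F0 : F 0 = 0 by rewrite -(scale0r 0) FZ scale0r.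
have F'0 : F' 0 = 0 by rewrite -(scale0r 0) F'Z scale0r.
have FM := reversal_anti wa wa' FD FZ FX.
have F'M := reversal_anti wa' wa F'D F'Z F'X.
have FK := reversal_K wa FD FZ FX F'D F'Z F'X.
have F'K := reversal_K wa' F'D F'Z F'X FD FZ FX.
split; [exact: (left_to_right FD F0 FM F'K) | exact: (right_to_left F'D F'0 F'M FK)].
Qed.

Lemma right_noetherian_iff (n : nat) (e : rel 'I_n) (K : fieldType) (A : lalgType K)
  (X : seq 'I_n -> A) (cf : seq 'I_n -> A -> K) :
  word_algebra e X cf -> oriented_graph e ->
  right_noetherian A <-> forall i : 'I_n,
    is_oriented_cycle e (component e i) \/ is_acyclic e (component e i).
Proof.
move=> wa e_or; split; last exact: (right_noetherian_of_components wa).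
by move=> nA i; apply: (noetherian_component e_or wa).
Qed.

Theorem theorem5p10 (n : nat) (e : rel 'I_n) (K : fieldType) :
  oriented_graph e ->
  (right_noetherian {malg K[HK e]} <-> left_noetherian {malg K[HK e]}) /\
  (left_noetherian {malg K[HK e]} <->
   forall i : 'I_n,
     is_oriented_cycle e (component e i) \/ is_acyclic e (component e i)).
Proof.
move=> e_or.
have right_iff := right_noetherian_iff (malg_word_algebra e K) e_or.
have left_iff : left_noetherian {malg K[HK e]} <-> forall i : 'I_n,
    is_oriented_cycle e (component e i) \/ is_acyclic e (component e i).
  apply: (iff_trans (left_right_reverse (malg_word_algebra e K)
    (malg_word_algebra (reverse_graph e) K))).
  apply: (iff_trans (right_noetherian_iff (malg_word_algebra (reverse_graph e) K)
    (reverse_oriented e_or))).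
  have flip (f : rel 'I_n) : (forall i, is_oriented_cycle f (component f i) \/
      is_acyclic f (component f i)) -> forall i,
      is_oriented_cycle (reverse_graph f) (component (reverse_graph f) i) \/
      is_acyclic (reverse_graph f) (component (reverse_graph f) i).
    move=> h i; rewrite reverse_component.
    by have [/reverse_is_cycle|/reverse_acyclic] := h i; [left | right].
  split; last exact: flip.
  exact: (flip (reverse_graph e)).
split=> //; exact: (iff_trans right_iff (iff_sym left_iff)).
Qed.
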